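(* In the weighted regression setting described in the context (martingale difference errors with conditional variance $\sigma^2(i/n,x_i)$, weights $p_i=p(i/n,x_i)$), let $$S_1(u)=\mathbb{E}\left[p_i(u)^2x_i(u)x_i(u)'\right],\quad S_2(u)=\mathbb{E}\left[p_i(u)^4\sigma_i(u)^2x_i(u)x_i(u)'\right],\quad S^*(u)=\mathbb{E}\left[\frac{x_i(u)x_i(u)'}{\sigma_i(u)^2}\right],$$ let $A$ be the $p_1\times(p_1+p_2)$ matrix that maps a vector of $\mathbb{R}^{p_1+p_2}$ to its first $p_1$ components, and let $$\Sigma^*=\mathbb{E}\int_0^1\frac{\widetilde x^*_{1,i}(u)\widetilde x^*_{1,i}(u)'}{\sigma_i(u)^2}\,du .$$ Then, for the order relation $\preceq$ of nonnegative definite matrices, $$\int_0^1AS_1(u)^{-1}S_2(u)S_1(u)^{-1}A'\,du\ \succeq\ \int_0^1AS^*(u)^{-1}A'\,du\ \succeq\ (\Sigma^* )^{-1}.$$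
   Context: Prime denotes transpose (except in $\xi'$); $\Vert U\Vert_r=\mathbb{E}^{1/r}(|U|^r)$; $\mathbb{E}^{-1}[\cdot]$ is the inverse matrix of the expectation. Dependence structure. $(\xi_k)_{k\in\mathbb{Z}}$ are i.i.d. with values in a measurable space $(E,\mathcal{E})$; $\mathcal{F}_k=(\xi_k,\xi_{k-1},\ldots)$ (also the generated $\sigma$-algebra); $\mathcal{F}_{0,k}=(\xi_0,\ldots,\xi_{-k+1},\xi'_{-k},\xi_{-k-1},\ldots)$ with $\xi'$ an independent copy of $\xi$. For a triangular array of measurable functions $J_{n,i}$ on $E^{\mathbb{N}}$, $1\le i\le n$: $\delta_{k,r}(J)=\sup_{n\ge1}\max_{1\le i\le n}\Vert J_{n,i}(\mathcal{F}_0)-J_{n,i}(\mathcal{F}_{0,k})\Vert_r$, $\Theta_{m,r}(J)=\sum_{k\ge m}\delta_{k,r}(J)$; finiteness of $\Theta_{0,r}(J)$ implicitly includes $\sup_{n,i}\Vert J_{n,i}(\mathcal{F}_0)\Vert_r<\infty$. Model. $y_i=x_{1,i}'\beta_1+x_{2,i}'\beta_2(i/n)+e_i$, $1\le i\le n$, with $\beta_1\in\mathbb{R}^{p_1}$, $\beta_2:[0,1]\to\mathbb{R}^{p_2}$ Lipschitz, $d_0=p_1+p_2$, $x_i=(x_{1,i}',x_{2,i}')'=G_{n,i}(\mathcal{F}_i)\in\mathbb{R}^{d_0}$ which is $\mathcal{F}_{i-1}$-measurable, $e_i=H_{n,i}(\mathcal{F}_i)\in\mathbb{R}$, $\mathbb{E}(e_i\mid\mathcal{F}_{i-1})=0$,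 $\mathrm{Var}(e_i\mid\mathcal{F}_{i-1})=\sigma^2(i/n,x_i)$ with $\sigma:[0,1]\times\mathbb{R}^{d_0}\to(0,\infty)$. For a weight function $p:[0,1]\times\mathbb{R}^{d_0}\to\mathbb{R}$ put $p_i=p(i/n,x_i)$ and consider the weighted model $p_iy_i=p_ix_{1,i}'\beta_1+p_ix_{2,i}'\beta_2(i/n)+p_ie_i$. Assumptions on the weighted model. There are stationary approximations $x_i(u)=(x_{1,i}(u)',x_{2,i}(u)')'=G(u,\mathcal{F}_i)$ and $e_i(u)=H(u,\mathcal{F}_i)$, $u\in[0,1]$, with $x_i(u)$ $\mathcal{F}_{i-1}$-measurable, $\mathbb{E}(e_i(u)\mid\mathcal{F}_{i-1})=0$, $\mathrm{Var}(e_i(u)\mid\mathcal{F}_{i-1})=\sigma_i(u)^2$, where $\sigma_i(u)=\sigma(u,x_i(u))$ and $p_i(u)=p(u,x_i(u))$, such that, with $X_i=p_ix_i$, $\varepsilon_i=p_ie_i$, $X_i(u)=p_i(u)x_i(u)$, $\varepsilon_i(u)=p_i(u)e_i(u)$: (i) $\max_{1\le i\le n}[\Vert X_i-X_i(i/n)\Vert_2+\Vert X_i\varepsilon_i-X_i(i/n)\varepsilon_i(i/n)\Vert_2]=O(1/n)$ and, for some $C>0$, $\Vert X_i(u)-X_i(v)\Vert_2+\Vert X_i(u)\varepsilon_i(u)-X_i(v)\varepsilon_i(v)\Vert_2\le C|u-v|$; (ii) there are $q>8/7$, $q_1>16/7$, $q_2>2$ with $1/q=1/q_1+1/q_2$ and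 $\Theta_{0,2q_1}+\Theta_{0,q_2}<\infty$ for the arrays of functions defining $X_i$ and $X_i\varepsilon_i$ respectively; (iii) $\det\mathbb{E}[X_i(u)X_i(u)']\ne0$ for each $u\in[0,1]$. These assumptions hold for the weight $p$ under consideration and also for the weight $\sigma^{-1}$. Notation. $q_2^*(u)=\mathbb{E}^{-1}[\sigma_i(u)^{-2}x_{2,i}(u)x_{2,i}(u)']\,\mathbb{E}[\sigma_i(u)^{-2}x_{2,i}(u)x_{1,i}(u)']$ and $\widetilde x^*_{1,i}(u)=x_{1,i}(u)-q_2^*(u)'x_{2,i}(u)$. (The first matrix in the claim is the asymptotic variance of the estimator of $\beta_1$ obtained by averaging the nonparametric estimator of $\beta(\cdot)$ in the weighted model; $(\Sigma^* )^{-1}$ is the optimal asymptotic variance for the partial-regression method.) *)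

(* Defs.v *)
From HB Require Import structures.
From mathcomp Require Import all_boot all_order all_algebra.
From mathcomp Require Import all_classical all_reals all_analysis.
Set Implicit Arguments.
Unset Strict Implicit.
Unset Printing Implicit Defensive.
Import Order.TTheory GRing.Theory Num.Theory.
Import numFieldNormedType.Exports.
Local Open Scope classical_set_scope.
Local Open Scope ring_scope.

(** * Measurable structures on [E ^ nat] and on [R ^ n] *)

(* Cylinders over a family of coordinate maps.  The sigma-algebra they generate
   is the product sigma-algebra; on column vectors it is the Borel one. *)
Definition cylinders (I aT : Type) (d : measure_display)
    (rT : measurableType d) (f : I -> aT -> rT) : set (set aT) :=
  \bigcup_i preimage_set_system setT (f i) measurable.

Notation pathType E :=
  (g_sigma_algebraType (cylinders (fun (k : nat) (x : nat -> E%type) => x k))).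

Definition col_coord (R : realType) (n : nat) (a : 'I_n) (x : 'cV[R]_n) :
  measurableTypeR R := x a ord0.

Notation colType R n := (g_sigma_algebraType (cylinders (@col_coord R n))).

(** * Independence and conditional moments *)

Section Probability.
Context (R : realType) (d : measure_display) (T : measurableType d).
Variable P : probability T R.

Definition mutually_independent (I : choiceType) (d' : measure_display)
    (E : measurableType d') (X : I -> T -> E) : Prop :=
  forall (s : seq I) (B : I -> set E),
    uniq s -> (forall i, measurable (B i)) ->
    P (\bigcap_(i in [set` s]) (X i @^-1` B i)) =
      (\prod_(i <- s) P (X i @^-1` B i))%E.

Definition iid (I : choiceType) (d' : measure_display)
    (E : measurableType d') (X : I -> T -> E) : Prop :=
  [/\ forall i, measurable_fun setT (X i),
      mutually_independent X
    & forall i j (B : set E), measurable B ->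
        P (X i @^-1` B) = P (X j @^-1` B)].

Definition adapted (F : set (set T)) (d' : measure_display)
    (T' : measurableType d') (X : T -> T') : Prop :=
  forall B : set T', measurable B -> F (X @^-1` B).

(* [Y] is a version of the conditional expectation of [X] given [F].  It is
   meant for [X] integrable or [X] nonnegative; in the latter case neither [X]
   nor [Y] has to be integrable. *)
Definition is_condexp (F : set (set T)) (X Y : T -> R) : Prop :=
  adapted F (Y : T -> measurableTypeR R) /\
  forall A, F A ->
    (\int[P]_(w in A) (X w)%:E = \int[P]_(w in A) (Y w)%:E)%E.

Definition is_condvar (F : set (set T)) (X V : T -> R) : Prop :=
  exists2 m : T -> R, is_condexp F X m &
    is_condexp F (fun w => (X w - m w) ^+ 2) V.

(* The library's norm on matrices is the sup norm. *)
Definition enorm (n : nat) (v : 'cV[R]_n) : R :=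
  Num.sqrt (\sum_(a < n) v a ord0 ^+ 2).

Definition normL (r : R) (n : nat) (U : T -> 'cV[R]_n) : \bar R :=
  Lnorm P r%:E (fun w => (enorm (U w))%:E).

Definition Emx (m n : nat) (U : T -> 'M[R]_(m, n)) : 'M[R]_(m, n) :=
  \matrix_(a < m, b < n) fine ('E_P[fun w => U w a b])%E.

End Probability.

Definition int01 (R : realType) (m n : nat) (U : R -> 'M[R]_(m, n)) :
    'M[R]_(m, n) :=
  \matrix_(a < m, b < n) \int[lebesgue_measure]_(u in `[0%R, 1%R]) U u a b.

Definition nonneg_definite (R : realType) (n : nat) (A : 'M[R]_n) : Prop :=
  A^T = A /\ forall v : 'cV[R]_n, 0 <= (v^T *m A *m v) ord0 ord0.

Definition loewner_le (R : realType) (n : nat) (A B : 'M[R]_n) : Prop :=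
  nonneg_definite (B - A).

(** * Bernoulli shifts and functional dependence *)

Section Dependence.
Context (T E : Type).
Variables xi xi' : int -> T -> E.

Definition past (i : int) (w : T) : nat -> E := fun k => xi (i - k%:Z) w.

Definition past_coupled (k : nat) (w : T) : nat -> E :=
  fun j => if j == k then xi' (- k%:Z) w else xi (- j%:Z) w.

End Dependence.

Definition past_sigma (d d' : measure_display) (T : measurableType d)
    (E : measurableType d') (xi : int -> T -> E) (i : int) : set (set T) :=
  g_sigma_algebra_preimage (past xi i : T -> pathType E).

(* [xi] is i.i.d. and [xi'] is an independent copy of it. *)
Definition innovations (R : realType) (d d' : measure_display)
    (T : measurableType d) (E : measurableType d') (P : probability T R)
    (xi xi' : int -> T -> E) : Prop :=
  iid P (fun b : bool * int => if b.1 then xi' b.2 else xi b.2).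

Section Functional_dependence.
Context (R : realType) (d d' : measure_display) (T : measurableType d)
  (E : measurableType d').
Variables (P : probability T R) (xi xi' : int -> T -> E) (n0 : nat).
Variable J : nat -> nat -> (nat -> E) -> 'cV[R]_n0.

(* delta_(k, r)(J) *)
Definition fdep (k : nat) (r : R) : \bar R :=
  ereal_sup [set a | exists n i : nat, [/\ (0 < i)%N, (i <= n)%N &
    a = normL P r
      (fun w => J n i (past xi 0 w) - J n i (past_coupled xi xi' k w))]].

Definition Theta (m : nat) (r : R) : \bar R :=
  (\sum_(m <= k <oo) fdep k r)%E.

Definition moment_sup (r : R) : \bar R :=
  ereal_sup [set a | exists n i : nat, [/\ (0 < i)%N, (i <= n)%N &
    a = normL P r (fun w => J n i (past xi 0 w))]].

Definition Theta0_finite (r : R) : Prop :=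
  (Theta 0 r < +oo)%E /\ (moment_sup r < +oo)%E.

End Functional_dependence.

(** * The regression model *)

(* [Gn n i], [Hn n i] define the triangular arrays x_i and e_i; [Gs u], [Hs u]
   define their stationary approximations x_i(u) and e_i(u).  Functions of
   u in [0, 1] are total on [R]; nothing is assumed outside [0, 1]. *)
Record regression (R : realType) (T E : Type) (p1 p2 : nat) := Regression {
  xi : int -> T -> E;
  xi' : int -> T -> E;
  Gn : nat -> nat -> (nat -> E) -> 'cV[R]_(p1 + p2);
  Hn : nat -> nat -> (nat -> E) -> R;
  Gs : R -> (nat -> E) -> 'cV[R]_(p1 + p2);
  Hs : R -> (nat -> E) -> R;
  sigma : R -> 'cV[R]_(p1 + p2) -> R;
  beta1 : 'cV[R]_p1;
  beta2 : R -> 'cV[R]_p2;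
  response : nat -> nat -> T -> R }.

Section Model.
Context (R : realType) (d d' : measure_display) (T : measurableType d)
  (E : measurableType d') (p1 p2 : nat).
Variables (P : probability T R) (M : regression R T E p1 p2).

Definition regressor (n i : nat) (w : T) : 'cV[R]_(p1 + p2) :=
  Gn M n i (past (xi M) i%:Z w).

Definition error (n i : nat) (w : T) : R := Hn M n i (past (xi M) i%:Z w).

(* Stationary approximations [x_i(u)], [e_i(u)] and [sigma_i(u)]. *)
Definition xs (i : int) (u : R) (w : T) : 'cV[R]_(p1 + p2) :=
  Gs M u (past (xi M) i w).

Definition es (i : int) (u : R) (w : T) : R := Hs M u (past (xi M) i w).

Definition sigmas (i : int) (u : R) (w : T) : R := sigma M u (xs i u w).

Definition regression_model : Prop :=
  [/\ exists L : R, forall u v : R, 0 <= u <= 1 -> 0 <= v <= 1 ->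
        enorm (beta2 M u - beta2 M v) <= L * `|u - v|,
      forall (u : R) x, 0 <= u <= 1 -> 0 < sigma M u x,
      measurable_fun
        [set z : measurableTypeR R * colType R (p1 + p2) | 0 <= z.1 <= 1]
        (fun z => sigma M z.1 z.2 : measurableTypeR R)
    & forall n i : nat, (0 < i)%N -> (i <= n)%N ->
      [/\ measurable_fun setT (Gn M n i : pathType E -> colType R (p1 + p2)),
          measurable_fun setT (Hn M n i : pathType E -> measurableTypeR R),
          forall w, response M n i w =
            ((usubmx (regressor n i w))^T *m beta1 M) ord0 ord0
            + ((dsubmx (regressor n i w))^T *m beta2 M (i%:R / n%:R))
                ord0 ord0
            + error n i w,
          adapted (past_sigma (xi M) (i%:Z - 1))
            (regressor n i : T -> colType R (p1 + p2))
        & [/\ P.-integrable setT (EFin \o error n i),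
              is_condexp P (past_sigma (xi M) (i%:Z - 1)) (error n i) (cst 0)
            & is_condvar P (past_sigma (xi M) (i%:Z - 1)) (error n i)
                (fun w => sigma M (i%:R / n%:R) (regressor n i w) ^+ 2)]]].

(* [Gs] is jointly measurable because [Sigma_star] integrates over [u] inside
   the expectation. *)
Definition stationary_approximation : Prop :=
  measurable_fun [set z : measurableTypeR R * pathType E | 0 <= z.1 <= 1]
    (fun z => Gs M z.1 z.2 : colType R (p1 + p2)) /\
  forall u : R, 0 <= u <= 1 ->
    measurable_fun setT (Hs M u : pathType E -> measurableTypeR R) /\
    forall i : int,
      [/\ adapted (past_sigma (xi M) (i - 1))
            (xs i u : T -> colType R (p1 + p2)),
          P.-integrable setT (EFin \o es i u),
          is_condexp P (past_sigma (xi M) (i - 1)) (es i u) (cst 0)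
        & is_condvar P (past_sigma (xi M) (i - 1)) (es i u)
            (fun w => sigmas i u w ^+ 2)].

Section Weighted.
Variable p : R -> 'cV[R]_(p1 + p2) -> R.

(* In the usual notation, [wX_fun] and [wXeps_fun] define X_i = p_i x_i and
   X_i eps_i with eps_i = p_i e_i; [wXs] and [wXepss] are X_i(u) and
   X_i(u) eps_i(u). *)
Definition wX_fun (n i : nat) (s : nat -> E) : 'cV[R]_(p1 + p2) :=
  p (i%:R / n%:R) (Gn M n i s) *: Gn M n i s.

Definition wXeps_fun (n i : nat) (s : nat -> E) : 'cV[R]_(p1 + p2) :=
  (p (i%:R / n%:R) (Gn M n i s) * Hn M n i s) *: wX_fun n i s.

Definition wX (n i : nat) (w : T) := wX_fun n i (past (xi M) i%:Z w).

Definition wXeps (n i : nat) (w : T) := wXeps_fun n i (past (xi M) i%:Z w).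

Definition wXs (i : int) (u : R) (w : T) : 'cV[R]_(p1 + p2) :=
  p u (xs i u w) *: xs i u w.

Definition wXepss (i : int) (u : R) (w : T) : 'cV[R]_(p1 + p2) :=
  (p u (xs i u w) * es i u w) *: wXs i u w.

Definition weighted_assumptions : Prop :=
  [/\ forall u : R, 0 <= u <= 1 ->
        measurable_fun setT
          (p u : colType R (p1 + p2) -> measurableTypeR R),
      (exists K : R, \forall n \near \oo, forall i : nat,
          (0 < i)%N -> (i <= n)%N ->
          (normL P 2 (fun w => (wX n i w - wXs i%:Z (i%:R / n%:R) w)%R)
           + normL P 2 (fun w => (wXeps n i w - wXepss i%:Z (i%:R / n%:R) w)%R)
           <= (K / n%:R)%:E)%E)
      /\ (exists2 C : R, 0 < C & forall (i : int) (u v : R),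
          0 <= u <= 1 -> 0 <= v <= 1 ->
          (normL P 2 (fun w => (wXs i u w - wXs i v w)%R)
           + normL P 2 (fun w => (wXepss i u w - wXepss i v w)%R)
           <= (C * `|u - v|)%:E)%E),
      exists q q1 q2 : R,
        [/\ 8 / 7 < q, 16 / 7 < q1, 2 < q2, 1 / q = 1 / q1 + 1 / q2
          & Theta0_finite P (xi M) (xi' M) wX_fun (2 * q1) /\
            Theta0_finite P (xi M) (xi' M) wXeps_fun q2]
    & forall (i : int) (u : R), 0 <= u <= 1 ->
        \det (Emx P (fun w => wXs i u w *m (wXs i u w)^T)) != 0].

Definition S1 (i : int) (u : R) : 'M[R]_(p1 + p2) :=
  Emx P (fun w => p u (xs i u w) ^+ 2 *: (xs i u w *m (xs i u w)^T)).

Definition S2 (i : int) (u : R) : 'M[R]_(p1 + p2) :=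
  Emx P (fun w => (p u (xs i u w) ^+ 4 * sigmas i u w ^+ 2)
                    *: (xs i u w *m (xs i u w)^T)).

End Weighted.

Definition S_star (i : int) (u : R) : 'M[R]_(p1 + p2) :=
  Emx P (fun w => (sigmas i u w ^+ 2)^-1 *: (xs i u w *m (xs i u w)^T)).

Definition xs1 (i : int) (u : R) (w : T) : 'cV[R]_p1 := usubmx (xs i u w).

Definition xs2 (i : int) (u : R) (w : T) : 'cV[R]_p2 := dsubmx (xs i u w).

Definition q2_star (i : int) (u : R) : 'M[R]_(p2, p1) :=
  invmx (Emx P (fun w => (sigmas i u w ^+ 2)^-1
                           *: (xs2 i u w *m (xs2 i u w)^T)))
  *m Emx P (fun w => (sigmas i u w ^+ 2)^-1
                       *: (xs2 i u w *m (xs1 i u w)^T)).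

Definition x1_tilde (i : int) (u : R) (w : T) : 'cV[R]_p1 :=
  xs1 i u w - (q2_star i u)^T *m xs2 i u w.

Definition Sigma_star (i : int) : 'M[R]_p1 :=
  Emx P (fun w => int01 (fun u => (sigmas i u w ^+ 2)^-1
                           *: (x1_tilde i u w *m (x1_tilde i u w)^T))).

End Model.

Definition first_coords (R : realType) (p1 p2 : nat) : 'M[R]_(p1, p1 + p2) :=
  row_mx 1%:M 0.

(* Main.v *)
Require Import Defs.
From mathcomp Require Import all_boot all_order all_algebra.
From mathcomp Require Import all_classical all_reals all_analysis.
From mathcomp Require Import measurable_realfun ring lra zify.
Set Implicit Arguments.
Unset Strict Implicit.
Unset Printing Implicit Defensive.
Import Order.TTheory GRing.Theory Num.Theory.
Import numFieldNormedType.Exports.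
Local Open Scope classical_set_scope.
Local Open Scope ring_scope.

(** Both inequalities state that a second moment matrix is nonnegative
    definite.

    For the first one, fix [u] and put [Y = p^2 sigma x] and [W = x / sigma].
    Then [E[Y Y'] = S2], [E[Y W'] = S1] and [E[W W'] = S*], and the second
    moment matrix of [S1^-1 Y - S*^-1 W] is [S1^-1 S2 S1^-1 - S*^-1]
    ([sandwich_ge_S_star_inv]).  Multiply by [A] and [A'] and integrate over
    [u].

    For the second one, write the residual as [x1 - q2*' x2 = K x], where
    [K A' = 1], and let [B] be the inverse of [Sigma*].  For each [u],
    [(A S*^-1 - B K) S* (A S*^-1 - B K)'] is nonnegative definite and equals
    [A S*^-1 A' - 2 B + B (K S* K') B] ([square_completion]).  Since the
    integral of [K S* K'] is [Sigma*], integration over [u] leaves the integral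
    of [A S*^-1 A'] minus [B].

    The analytic part shows that these integrals exist and may be manipulated
    in this way.  The law of the past does not depend on the time ([past_law]),
    so the moment condition on the arrays passes to their stationary
    approximations ([approx_sqvec]), which are Lipschitz in mean square; their
    second moments are then continuous in [u] ([moment_continuous]).  For [S2]
    this is applied to [X eps], from which [p^2 sigma x] is obtained by
    conditioning ([condvar_gram]).  Second moment matrices with nonzero
    determinant are positive definite ([nonneg_definite_posdef]), so that
    inverses are continuous too, [Sigma*] is invertible ([posdef_int01]), and
    Fubini identifies it with the integral of [K S* K'] ([Emx_int01]). *)

(** * Positive definite matrices *)

Section Matrices.
Variable R : realType.

Definition posdef (n : nat) (S : 'M[R]_n) : Prop :=
  S^T = S /\ forall v : 'cV[R]_n, v != 0 -> 0 < (v^T *m S *m v) ord0 ord0.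

Lemma normsq_ge0 (n : nat) (v : 'cV[R]_n) : 0 <= (v^T *m v) ord0 ord0.
Proof. by rewrite mxE sumr_ge0// => a _; rewrite mxE -expr2 sqr_ge0. Qed.

Lemma normsq_eq0 (n : nat) (v : 'cV[R]_n) : (v^T *m v) ord0 ord0 = 0 -> v = 0.
Proof.
rewrite mxE => v0; apply/matrixP => a b; rewrite ord1 mxE.
have /psumr_eq0P H : forall i, true -> 0 <= v^T ord0 i * v i ord0.
  by move=> i _; rewrite mxE -expr2 sqr_ge0.
by have := H v0 a isT; rewrite mxE -expr2 => /eqP; rewrite sqrf_eq0 => /eqP.
Qed.

(** If [v' S v = 0], then [(v - t S v)' S (v - t S v)] is, as a function of
    [t], a nonnegative quadratic polynomial without constant term, so its slope
    [-2 |S v|^2] vanishes.  Hence a nonnegative definite matrix without kernel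
    is positive definite. *)
Lemma nonneg_definite_posdef (n : nat) (S : 'M[R]_n) :
  nonneg_definite S -> \det S != 0 -> posdef S.
Proof.
move=> [St S0] dS; split=> // v v0; rewrite lt_neqAle S0 andbT eq_sym.
apply/negP => /eqP vSv; move/negP: v0; apply.
pose w := S *m v; pose a := (w^T *m w) ord0 ord0.
pose c := (w^T *m S *m w) ord0 ord0.
have wt : w^T = v^T *m S by rewrite trmx_mul St.
have key (t : R) : 0 <= - (2 * t * a) + t ^+ 2 * c.
  have := S0 (v - t *: w); rewrite [(v - _)^T]linearB /= [(t *: w)^T]linearZ /=.
  rewrite !mulmxBl !mulmxBr.
  rewrite -?scalemxAr -?scalemxAl -?scalemxAr -[v^T *m S]wt.
  have -> : w^T *m S *m v = w^T *m w by rewrite -mulmxA.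
  have vSv' : (w^T *m v) ord0 ord0 = 0 by rewrite wt.
  move: vSv'; rewrite /a /c.
  move: (w^T *m v) (w^T *m w) (w^T *m S *m w) => x y z vSv'.
  rewrite !mxE vSv'; move: (y _ _) (z _ _) => {}y {}z.
  by have -> : 0 - t * y - (t * y - t * (t * z)) = - (2 * t * y) + t ^+ 2 * z
    by ring.
(* the polynomial of [key] is negative at [t = a / (c + 1)] unless [a = 0] *)
have a0 : a = 0.
  have c0 : 0 <= c := S0 w; have := normsq_ge0 w; rewrite -/a => a0.
  have c1 : 0 < c + 1 by rewrite ltr_wpDl.
  have := key (a / (c + 1)).
  have -> : - (2 * (a / (c + 1)) * a) + (a / (c + 1)) ^+ 2 * c =
      - ((a / (c + 1)) ^+ 2 * (c + 2)).
    by field; rewrite gt_eqF.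
  rewrite oppr_ge0 => H.
  have := mulr_ge0 (sqr_ge0 (a / (c + 1))) (ltW (ltr_wpDl c0 (ltr0n _ 2))).
  move=> H2; have /eqP : (a / (c + 1)) ^+ 2 * (c + 2) = 0.
    by apply/eqP; rewrite eq_le H H2.
  by rewrite mulf_eq0 (gt_eqF (ltr_wpDl c0 _))// orbF sqrf_eq0 mulf_eq0
    invr_eq0 (gt_eqF c1) orbF => /eqP.
have Sv0 : S *m v = 0 by exact: normsq_eq0.
have uS : S \in unitmx by rewrite unitmxE unitfE.
by rewrite -(mulKmx uS v) Sv0 mulmx0.
Qed.

Lemma posdef_unitmx (n : nat) (S : 'M[R]_n) : posdef S -> S \in unitmx.
Proof.
move=> [St S0]; rewrite unitmxE unitfE; apply/negP => /det0P [v v0 vS].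
have := S0 v^T; rewrite trmx_eq0 => /(_ v0).
by rewrite trmxK vS mul0mx mxE ltxx.
Qed.

(** The right inverse [L] makes [K'] injective. *)
Lemma posdef_congr (m n : nat) (S : 'M[R]_n) (K : 'M[R]_(m, n))
    (L : 'M[R]_(n, m)) :
  K *m L = 1%:M -> posdef S -> posdef (K *m S *m K^T).
Proof.
move=> KL [St S0]; split; first by rewrite !trmx_mul trmxK St mulmxA.
move=> v v0; have Kv0 : K^T *m v != 0.
  apply: contra v0 => /eqP Kv; apply/eqP; rewrite -[v]mul1mx.
  have -> : (1%:M : 'M[R]_m) = L^T *m K^T by rewrite -trmx_mul KL trmx1.
  by rewrite -mulmxA Kv mulmx0.
by have := S0 _ Kv0; rewrite trmx_mul trmxK !mulmxA.
Qed.

Lemma nonneg_definite_congr (m n : nat) (S : 'M[R]_n) (K : 'M[R]_(m, n)) :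
  nonneg_definite S -> nonneg_definite (K *m S *m K^T).
Proof.
move=> [St S0]; split; first by rewrite !trmx_mul trmxK St mulmxA.
by move=> v; have := S0 (K^T *m v); rewrite trmx_mul trmxK !mulmxA.
Qed.

Lemma posdef_nonneg (n : nat) (S : 'M[R]_n) : posdef S -> nonneg_definite S.
Proof.
move=> [St S0]; split=> // v; have [->|/S0/ltW//] := eqVneq v 0.
by rewrite mulmx0 mxE.
Qed.

Lemma invmx_sym (n : nat) (S : 'M[R]_n) : S^T = S -> (invmx S)^T = invmx S.
Proof. by move=> St; rewrite trmx_inv St. Qed.

Lemma dr_block_congr (m n : nat) (S : 'M[R]_(m + n)) :
  drsubmx S = row_mx 0 1%:M *m S *m (row_mx 0 1%:M : 'M[R]_(n, m + n))^T.
Proof.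
rewrite -[in RHS](submxK S) tr_row_mx trmx0 trmx1 mul_row_block !mul0mx.
by rewrite !mul1mx !add0r mul_row_col mulmx0 mulmx1 add0r.
Qed.

(** The matrix is [(A S^-1 - B K) S (A S^-1 - B K)']: the cross terms
    [A K' B'] and [B K A'] both equal [B] because [K A' = 1]. *)
Lemma square_completion (m n : nat) (S : 'M[R]_n)
    (A K : 'M[R]_(m, n)) (B : 'M[R]_m) :
  posdef S -> K *m A^T = 1%:M -> B^T = B ->
  nonneg_definite (A *m invmx S *m A^T +
    (B *m (K *m S *m K^T) *m B^T - (B + B))).
Proof.
move=> pS KA Bt; have uS := posdef_unitmx pS.
have It : (invmx S)^T = invmx S by apply: invmx_sym; case: pS.
have AK : A *m K^T = 1%:M.
  by rewrite -[A *m K^T]trmxK trmx_mul trmxK KA trmx1.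
have := nonneg_definite_congr (A *m invmx S - B *m K) (posdef_nonneg pS).
rewrite [(A *m invmx S - _)^T]linearB /= !trmx_mul It Bt !mulmxBl !mulmxBr.
have -> : A *m invmx S *m S *m (invmx S *m A^T) = A *m invmx S *m A^T.
  by rewrite -[A *m invmx S *m S]mulmxA mulVmx// mulmx1 mulmxA.
have -> : A *m invmx S *m S *m (K^T *m B) = B.
  by rewrite -[A *m invmx S *m S]mulmxA mulVmx// mulmx1 mulmxA AK mul1mx.
have -> : B *m K *m S *m (invmx S *m A^T) = B.
  by rewrite mulmxA mulmxK// -mulmxA KA mulmx1.
have -> : B *m K *m S *m (K^T *m B) = B *m (K *m S *m K^T) *m B.
  by rewrite !mulmxA.
by rewrite opprB addrACA -opprD -addrA.
Qed.

End Matrices.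

(** * Continuity on the unit interval *)

Section Continuity.
Variable R : realType.
Notation I01 := (`[0%R, 1%R]%classic : set R).

Definition cont01 (f : R -> R) : Prop := {within I01, continuous f}.

Definition mxcont01 (m n : nat) (U : R -> 'M[R]_(m, n)) : Prop :=
  forall a b, cont01 (fun u => U u a b).

Lemma cont01P (f : R -> R) : cont01 f <->
  forall u : R, 0 <= u <= 1 -> f v @[v --> within I01 (nbhs u)] --> f u.
Proof.
split=> [/subspace_continuousP H u u01|H].
  by apply: H; rewrite /= in_itv.
by apply/subspace_continuousP => u; rewrite /= in_itv /= => /H.
Qed.

(** Values outside the unit interval are irrelevant for relative continuity. *)
Lemma cont01_eq (f g : R -> R) :
  (forall u : R, 0 <= u <= 1 -> f u = g u) -> cont01 f -> cont01 g.
Proof.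
move=> fg /cont01P cf; apply/cont01P => u u01; rewrite -fg//.
apply: cvg_trans (cf _ u01); apply: near_eq_cvg; near=> v; apply: fg.
have : I01 v by near: v; exact: withinT.
by rewrite /= in_itv.
Unshelve. all: by end_near. Qed.

Lemma cont01_cst (c : R) : cont01 (fun=> c).
Proof. by apply/cont01P => u _; exact: cvg_cst. Qed.

Lemma cont01D (f g : R -> R) :
  cont01 f -> cont01 g -> cont01 (fun u => f u + g u).
Proof.
move=> /cont01P cf /cont01P cg; apply/cont01P => u u01.
by apply: cvgD; [exact: cf|exact: cg].
Qed.

Lemma cont01M (f g : R -> R) :
  cont01 f -> cont01 g -> cont01 (fun u => f u * g u).
Proof.
move=> /cont01P cf /cont01P cg; apply/cont01P => u u01.
by apply: cvgM; [exact: cf|exact: cg].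
Qed.

Lemma cont01V (f : R -> R) : (forall u : R, 0 <= u <= 1 -> f u != 0) ->
  cont01 f -> cont01 (fun u => (f u)^-1).
Proof.
move=> f0 /cont01P cf; apply/cont01P => u u01.
by apply: cvgV; [exact: f0|exact: cf].
Qed.

Lemma cont01_sum (I : Type) (s : seq I) (Q : pred I) (f : I -> R -> R) :
  (forall i, cont01 (f i)) -> cont01 (fun u => \sum_(i <- s | Q i) f i u).
Proof.
move=> cf; elim: s => [|i s IH].
  by under [X in cont01 X]eq_fun do rewrite big_nil; exact: cont01_cst.
under [X in cont01 X]eq_fun do rewrite big_cons.
by case: (Q i) => //; apply: cont01D.
Qed.

Lemma cont01_prod (I : Type) (s : seq I) (Q : pred I) (f : I -> R -> R) :
  (forall i, cont01 (f i)) -> cont01 (fun u => \prod_(i <- s | Q i) f i u).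
Proof.
move=> cf; elim: s => [|i s IH].
  by under [X in cont01 X]eq_fun do rewrite big_nil; exact: cont01_cst.
under [X in cont01 X]eq_fun do rewrite big_cons.
by case: (Q i) => //; apply: cont01M.
Qed.

Lemma mxcont01_cst (m n : nat) (U : 'M[R]_(m, n)) : mxcont01 (fun=> U).
Proof. by move=> a b; exact: cont01_cst. Qed.

Lemma mxcont01M (m n k : nat) (U : R -> 'M[R]_(m, n)) (V : R -> 'M[R]_(n, k)) :
  mxcont01 U -> mxcont01 V -> mxcont01 (fun u => U u *m V u).
Proof.
move=> cU cV a b; under [X in cont01 X]eq_fun do rewrite mxE.
by apply: cont01_sum => c; exact: cont01M.
Qed.

Lemma mxcont01B (m n : nat) (U V : R -> 'M[R]_(m, n)) :
  mxcont01 U -> mxcont01 V -> mxcont01 (fun u => U u - V u).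
Proof.
move=> cU cV a b.
apply: (@cont01_eq (fun u => U u a b + -1 * V u a b)).
  by move=> u _; rewrite !mxE mulN1r.
by apply: cont01D => //; apply: cont01M => //; exact: cont01_cst.
Qed.

Lemma mxcont01_tr (m n : nat) (U : R -> 'M[R]_(m, n)) :
  mxcont01 U -> mxcont01 (fun u => (U u)^T).
Proof.
by move=> cU a b; under [X in cont01 X]eq_fun do rewrite mxE; exact: cU.
Qed.

Lemma mxcont01_dlsub (m n k l : nat)
    (U : R -> 'M[R]_(m + n, k + l)) :
  mxcont01 U -> mxcont01 (fun u => dlsubmx (U u)).
Proof.
by move=> cU a b; under [X in cont01 X]eq_fun do rewrite !mxE; exact: cU.
Qed.

Lemma mxcont01_drsub (m n k l : nat)
    (U : R -> 'M[R]_(m + n, k + l)) :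
  mxcont01 U -> mxcont01 (fun u => drsubmx (U u)).
Proof.
by move=> cU a b; under [X in cont01 X]eq_fun do rewrite !mxE; exact: cU.
Qed.

Lemma cont01_det (n : nat) (U : R -> 'M[R]_n) :
  mxcont01 U -> cont01 (fun u => \det (U u)).
Proof.
move=> cU; rewrite /determinant; apply: cont01_sum => s.
by apply: cont01M; [exact: cont01_cst|exact: cont01_prod].
Qed.

(** The inverse is the adjugate divided by the determinant, and both are
    polynomial in the entries. *)
Lemma mxcont01_inv (n : nat) (U : R -> 'M[R]_n) :
  (forall u : R, 0 <= u <= 1 -> U u \in unitmx) ->
  mxcont01 U -> mxcont01 (fun u => invmx (U u)).
Proof.
move=> uU cU a b.
apply: (@cont01_eq (fun u => (\det (U u))^-1 * \adj (U u) a b)).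
  by move=> u u01; rewrite /invmx uU// [RHS]mxE.
apply: cont01M.
  apply: cont01V; last exact: cont01_det.
  by move=> u /uU; rewrite unitmxE unitfE.
under [X in cont01 X]eq_fun do rewrite mxE /cofactor.
apply: cont01M; first exact: cont01_cst.
apply: cont01_det => k l.
by under [X in cont01 X]eq_fun do rewrite !mxE; exact: cU.
Qed.

Lemma cont01_integrable (f : R -> R) :
  cont01 f -> lebesgue_measure.-integrable I01 (EFin \o f).
Proof. by apply: continuous_compact_integrable; exact: segment_compact. Qed.

Lemma cont01_measurable (f : R -> R) :
  cont01 f -> measurable_fun (I01 : set (measurableTypeR R))
    (f : measurableTypeR R -> measurableTypeR R).
Proof. by move=> cf; apply: subspace_continuous_measurable_fun. Qed.

Lemma Rintegral01_cst (c : R) : \int[lebesgue_measure]_(u in I01) c = c.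
Proof.
rewrite Rintegral_cst//= lebesgue_measure_itv /= lte_fin ltr01 /=.
by rewrite oppr0 addr0 mulr1.
Qed.

(** A continuous positive function is bounded below by its minimum over the
    compact interval, which is positive. *)
Lemma Rintegral01_gt0 (f : R -> R) : cont01 f ->
  (forall u : R, 0 <= u <= 1 -> 0 < f u) ->
  0 < \int[lebesgue_measure]_(u in I01) f u.
Proof.
move=> cf f0; have [c c01 cmin] := EVT_min ler01 cf.
apply: (@lt_le_trans _ _ (f c)); first by apply: f0; rewrite in_itv in c01.
rewrite -[leLHS]Rintegral01_cst; apply: le_Rintegral => //.
  exact: (cont01_integrable (@cont01_cst (f c))).
exact: cont01_integrable.
Qed.

End Continuity.

(** * Integrals of matrix-valued functions *)

Section Matrix_integral.
Context (R : realType) (d : measure_display) (T : measurableType d).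
Variables (mu : {measure set T -> \bar R}) (D : set T).
Hypothesis mD : measurable D.

(** Common form of [Emx], where [D] is the whole space, and of [int01]. *)
Definition mxint (m n : nat) (U : T -> 'M[R]_(m, n)) : 'M[R]_(m, n) :=
  \matrix_(a < m, b < n) \int[mu]_(x in D) U x a b.

Definition mxintegrable (m n : nat) (U : T -> 'M[R]_(m, n)) : Prop :=
  forall a b, mu.-integrable D (EFin \o (fun x => U x a b)).

Lemma eq_mxint (m n : nat) (U V : T -> 'M[R]_(m, n)) :
  (forall x, D x -> U x = V x) -> mxint U = mxint V.
Proof.
move=> UV; apply/matrixP => a b; rewrite !mxE; apply: eq_Rintegral => x.
by rewrite inE => /UV ->.
Qed.

Lemma eq_mxintegrable (m n : nat) (U V : T -> 'M[R]_(m, n)) :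
  (forall x, D x -> U x = V x) -> mxintegrable U -> mxintegrable V.
Proof.
move=> UV iU a b; apply: eq_integrable (iU a b) => //= x.
by rewrite inE => /UV ->.
Qed.

Lemma mxintegrableD (m n : nat) (U V : T -> 'M[R]_(m, n)) :
  mxintegrable U -> mxintegrable V -> mxintegrable (fun x => U x + V x).
Proof.
move=> iU iV a b; have := integrableD mD (iU a b) (iV a b).
by apply: eq_integrable => //= x _; rewrite mxE EFinD.
Qed.

Lemma mxintD (m n : nat) (U V : T -> 'M[R]_(m, n)) :
  mxintegrable U -> mxintegrable V ->
  mxint (fun x => U x + V x) = mxint U + mxint V.
Proof.
move=> iU iV; apply/matrixP => a b; rewrite !mxE -RintegralD//.
by apply: eq_Rintegral => x _; rewrite mxE.
Qed.

Let integrable_lin (I : Type) (s : seq I) (c : I -> R) (f : I -> T -> R) :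
  (forall i, mu.-integrable D (EFin \o f i)) ->
  mu.-integrable D (EFin \o (fun x => \sum_(i <- s) c i * f i x)) /\
  \int[mu]_(x in D) (\sum_(i <- s) c i * f i x) =
    \sum_(i <- s) c i * \int[mu]_(x in D) f i x.
Proof.
move=> fi; elim: s => [|i s [IH1 IH2]].
  split; last by under eq_Rintegral do rewrite big_nil;
    rewrite big_nil Rintegral_cst// mul0r.
  by apply: eq_integrable (integrable0 mu D) => //= x _; rewrite big_nil.
have cfi : mu.-integrable D (EFin \o (fun x => c i * f i x)).
  by have := integrableZl mD (c i) (fi i); apply: eq_integrable.
split.
  have := integrableD mD cfi IH1.
  by apply: eq_integrable => //= x _; rewrite big_cons EFinD.
under eq_Rintegral do rewrite big_cons.
by rewrite RintegralD// IH2 RintegralZl// big_cons.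
Qed.

Lemma mxintegrable_mull (m n k : nat) (B : 'M[R]_(m, n))
    (U : T -> 'M[R]_(n, k)) :
  mxintegrable U -> mxintegrable (fun x => B *m U x).
Proof.
move=> iU a b.
have [+ _] := integrable_lin (index_enum 'I_n) (fun c => B a c)
  (fun c => iU c b).
by apply: eq_integrable => //= x _; rewrite mxE.
Qed.

Lemma mxint_mull (m n k : nat) (B : 'M[R]_(m, n)) (U : T -> 'M[R]_(n, k)) :
  mxintegrable U -> mxint (fun x => B *m U x) = B *m mxint U.
Proof.
move=> iU; apply/matrixP => a b; rewrite !mxE.
under eq_Rintegral do rewrite mxE.
have [_ ->] := integrable_lin (index_enum 'I_n) (fun c => B a c)
  (fun c => iU c b).
by apply: eq_bigr => c _; rewrite mxE.
Qed.

Lemma mxint_tr (m n : nat) (U : T -> 'M[R]_(m, n)) :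
  (mxint U)^T = mxint (fun x => (U x)^T).
Proof.
apply/matrixP => a b; rewrite !mxE.
by apply: eq_Rintegral => x _; rewrite mxE.
Qed.

Lemma mxintegrable_tr (m n : nat) (U : T -> 'M[R]_(m, n)) :
  mxintegrable U -> mxintegrable (fun x => (U x)^T).
Proof.
by move=> iU a b; apply: eq_integrable (iU b a) => //= x _; rewrite mxE.
Qed.

Lemma mxintegrable_mulr (m n k : nat) (U : T -> 'M[R]_(m, n))
    (B : 'M[R]_(n, k)) :
  mxintegrable U -> mxintegrable (fun x => U x *m B).
Proof.
move=> /mxintegrable_tr/(mxintegrable_mull B^T)/mxintegrable_tr.
by apply: eq_mxintegrable => x _; rewrite trmx_mul !trmxK.
Qed.

Lemma mxint_mulr (m n k : nat) (U : T -> 'M[R]_(m, n)) (B : 'M[R]_(n, k)) :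
  mxintegrable U -> mxint (fun x => U x *m B) = mxint U *m B.
Proof.
move=> /mxintegrable_tr iU; apply: trmx_inj; rewrite trmx_mul !mxint_tr.
by rewrite -mxint_mull//; apply: eq_mxint => x _; rewrite trmx_mul.
Qed.

Lemma mxintegrable_congr (m n : nat) (B : 'M[R]_(m, n)) (U : T -> 'M[R]_n) :
  mxintegrable U -> mxintegrable (fun x => B *m U x *m B^T).
Proof. by move=> iU; exact/mxintegrable_mulr/mxintegrable_mull. Qed.

Lemma mxint_congr (m n : nat) (B : 'M[R]_(m, n)) (U : T -> 'M[R]_n) :
  mxintegrable U -> mxint (fun x => B *m U x *m B^T) = B *m mxint U *m B^T.
Proof.
by move=> iU; rewrite mxint_mulr ?mxint_mull//; exact: mxintegrable_mull.
Qed.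

Lemma mxintN (m n : nat) (U : T -> 'M[R]_(m, n)) : mxintegrable U ->
  mxint (fun x => - U x) = - mxint U.
Proof.
move=> iU; rewrite -[mxint U]mul1mx -mulNmx -mxint_mull//.
by apply: eq_mxint => x _; rewrite mulNmx mul1mx.
Qed.

Lemma mxintegrableN (m n : nat) (U : T -> 'M[R]_(m, n)) : mxintegrable U ->
  mxintegrable (fun x => - U x).
Proof.
move=> /(mxintegrable_mull (- 1%:M)); apply: eq_mxintegrable => x _.
by rewrite mulNmx mul1mx.
Qed.

Lemma mxint_qform (n : nat) (U : T -> 'M[R]_n) (v : 'cV[R]_n) :
  mxintegrable U ->
  (v^T *m mxint U *m v) ord0 ord0 =
    \int[mu]_(x in D) (v^T *m U x *m v) ord0 ord0.
Proof.
move=> iU; have := mxint_congr v^T iU; rewrite trmxK => <-.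
by rewrite mxE.
Qed.

Lemma nonneg_definite_mxint (n : nat) (U : T -> 'M[R]_n) :
  mxintegrable U -> (forall x, D x -> nonneg_definite (U x)) ->
  nonneg_definite (mxint U).
Proof.
move=> iU U0; split.
  by rewrite mxint_tr; apply: eq_mxint => x /U0[].
move=> v; rewrite mxint_qform//; apply: Rintegral_ge0 => x Dx.
by have [_] := U0 x Dx.
Qed.

End Matrix_integral.

Lemma EmxE (R : realType) (d : measure_display) (T : measurableType d)
    (P : probability T R) (m n : nat) (U : T -> 'M[R]_(m, n)) :
  Emx P U = mxint P setT U.
Proof. by apply/matrixP => a b; rewrite !mxE unlock. Qed.

Lemma int01E (R : realType) (m n : nat) (U : R -> 'M[R]_(m, n)) :
  int01 U = mxint lebesgue_measure `[0%R, 1%R]%classic U.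
Proof. by []. Qed.

Lemma mxcont01_integrable (R : realType) (m n : nat) (U : R -> 'M[R]_(m, n)) :
  mxcont01 U -> mxintegrable lebesgue_measure `[0%R, 1%R]%classic U.
Proof. by move=> cU a b; exact: cont01_integrable. Qed.

Lemma posdef_int01 (R : realType) (n : nat) (U : R -> 'M[R]_n) :
  mxcont01 U -> (forall u : R, 0 <= u <= 1 -> posdef (U u)) ->
  posdef (int01 U).
Proof.
move=> cU U0; have iU := mxcont01_integrable cU; rewrite int01E; split.
  rewrite mxint_tr; apply: eq_mxint => u /=.
  by rewrite in_itv /= => /U0[].
move=> v v0; rewrite mxint_qform//; apply: Rintegral01_gt0.
  have c1 : mxcont01 (fun u => v^T *m U u *m v).
    apply: mxcont01M; [apply: mxcont01M => //|]; exact: mxcont01_cst.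
  exact: c1.
by move=> u /U0[_]; exact.
Qed.

Lemma int01_cst (R : realType) (m n : nat) (L : 'M[R]_(m, n)) :
  int01 (fun=> L) = L.
Proof. by apply/matrixP => a b; rewrite mxE Rintegral01_cst. Qed.

(** * Square-integrable random vectors *)

Section Second_moments.
Context (R : realType) (d : measure_display) (T : measurableType d).
Variable P : probability T R.

Definition sqint (f : T -> R) : Prop :=
  measurable_fun setT f /\
  P.-integrable setT (EFin \o (fun w => f w ^+ 2)).

Definition sqvec (n : nat) (U : T -> 'cV[R]_n) : Prop :=
  forall a, sqint (fun w => U w a ord0).

Lemma integrable_dom (f g : T -> R) : measurable_fun setT f ->
  (forall w, `|f w| <= g w) -> P.-integrable setT (EFin \o g) ->
  P.-integrable setT (EFin \o f).
Proof.
move=> mf fg; apply: le_integrable => //; first exact/measurable_EFinP.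
by move=> w _ /=; rewrite lee_fin (le_trans (fg w)) ?ler_norm.
Qed.

Lemma integrableD_EFin (f g : T -> R) :
  P.-integrable setT (EFin \o f) -> P.-integrable setT (EFin \o g) ->
  P.-integrable setT (EFin \o (fun w => f w + g w)).
Proof. by move=> fi gi; have := integrableD measurableT fi gi. Qed.

Lemma integrableZ_EFin (c : R) (f : T -> R) :
  P.-integrable setT (EFin \o f) ->
  P.-integrable setT (EFin \o (fun w => c * f w)).
Proof. by move=> fi; have := integrableZl measurableT c fi. Qed.

Lemma sqint_mul (f g : T -> R) :
  sqint f -> sqint g -> P.-integrable setT (EFin \o (fun w => f w * g w)).
Proof.
move=> [mf f2] [mg g2]; apply: integrable_dom (integrableD_EFin f2 g2).
  exact: measurable_funM.
move=> w /=; rewrite normrM -[f w ^+ 2]real_normK ?num_real//.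
rewrite -[g w ^+ 2]real_normK ?num_real//.
have := normr_ge0 (f w); have := normr_ge0 (g w).
by move: `|f w| `|g w| => x y x0 y0; nra.
Qed.

Lemma sqintD (f g : T -> R) :
  sqint f -> sqint g -> sqint (fun w => f w + g w).
Proof.
move=> [mf f2] [mg g2]; have m := measurable_funD mf mg; split=> //.
apply: integrable_dom (integrableZ_EFin 2 (integrableD_EFin f2 g2)).
  exact: measurable_funX.
move=> w /=; rewrite ger0_norm ?sqr_ge0//.
by have := sqr_ge0 (f w - g w); move: (f w) (g w) => x y; nra.
Qed.

Lemma sqintZ (c : R) (f : T -> R) : sqint f -> sqint (fun w => c * f w).
Proof.
move=> [mf f2]; split; first exact: measurable_funM.
have := integrableZ_EFin (c ^+ 2) f2.
by apply: eq_integrable => //= w _; rewrite exprMn.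
Qed.

Lemma sqintN (f : T -> R) : sqint f -> sqint (fun w => - f w).
Proof.
move=> /(sqintZ (-1)); rewrite (_ : (fun w => -1 * f w) = (fun w => - f w))//.
by apply/funext => w; rewrite mulN1r.
Qed.

Lemma sqint_sum (I : Type) (s : seq I) (f : I -> T -> R) :
  (forall i, sqint (f i)) -> sqint (fun w => \sum_(i <- s) f i w).
Proof.
move=> fi; elim: s => [|i s IH].
  under [X in sqint X]eq_fun do rewrite big_nil.
  split=> //; have := integrable0 P (setT : set T).
  by apply: eq_integrable => //= w _; rewrite expr0n.
under [X in sqint X]eq_fun do rewrite big_cons.
exact: sqintD.
Qed.

Lemma sqvec_mull (m n : nat) (B : 'M[R]_(m, n)) (U : T -> 'cV[R]_n) :
  sqvec U -> sqvec (fun w => B *m U w).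
Proof.
move=> sU a; under [X in sqint X]eq_fun do rewrite mxE.
by apply: sqint_sum => b; exact: sqintZ.
Qed.

Lemma sqvecB (n : nat) (U V : T -> 'cV[R]_n) :
  sqvec U -> sqvec V -> sqvec (fun w => U w - V w).
Proof.
move=> sU sV a; under [X in sqint X]eq_fun do rewrite !mxE.
by apply: sqintD => //; exact: sqintN.
Qed.

Lemma gram_integrable (m n : nat) (U : T -> 'cV[R]_m) (V : T -> 'cV[R]_n) :
  sqvec U -> sqvec V -> mxintegrable P setT (fun w => U w *m (V w)^T).
Proof.
move=> sU sV a b; have := sqint_mul (sU a) (sV b).
by apply: eq_integrable => //= w _; rewrite mxE big_ord1 mxE.
Qed.

Lemma gram_nonneg (n : nat) (U : T -> 'cV[R]_n) :
  sqvec U -> nonneg_definite (Emx P (fun w => U w *m (U w)^T)).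
Proof.
move=> sU; rewrite EmxE; apply: nonneg_definite_mxint => //.
  exact: gram_integrable.
move=> w _; split; first by rewrite trmx_mul trmxK.
move=> v; have := normsq_ge0 ((U w)^T *m v).
by rewrite trmx_mul trmxK !mulmxA.
Qed.

Lemma gram_mull (m n : nat) (B : 'M[R]_(m, n)) (U : T -> 'cV[R]_n) :
  sqvec U -> Emx P (fun w => (B *m U w) *m (B *m U w)^T) =
    B *m Emx P (fun w => U w *m (U w)^T) *m B^T.
Proof.
move=> sU; rewrite !EmxE -mxint_congr//; last exact: gram_integrable.
by apply: eq_mxint => w _; rewrite trmx_mul !mulmxA.
Qed.

Lemma gramB (m n k : nat) (B : 'M[R]_(k, m)) (C : 'M[R]_(k, n))
    (Y : T -> 'cV[R]_m) (W : T -> 'cV[R]_n)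
    (S := Emx P (fun w => Y w *m (W w)^T)) :
  sqvec Y -> sqvec W ->
  Emx P (fun w => (B *m Y w - C *m W w) *m (B *m Y w - C *m W w)^T) =
    (B *m Emx P (fun w => Y w *m (Y w)^T) *m B^T - B *m S *m C^T) -
    (C *m S^T *m B^T - C *m Emx P (fun w => W w *m (W w)^T) *m C^T).
Proof.
move=> sY sW; rewrite /S !EmxE.
have iYY := gram_integrable sY sY.
have iYW := gram_integrable sY sW.
have iWW := gram_integrable sW sW.
have iWY := mxintegrable_tr measurableT iYW.
have i1 := mxintegrable_congr measurableT B iYY.
have i2 := mxintegrable_mulr measurableT (C^T)
  (mxintegrable_mull measurableT B iYW).
have i3 := mxintegrable_mulr measurableT (B^T)
  (mxintegrable_mull measurableT C iWY).
have i4 := mxintegrable_congr measurableT C iWW.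
have mull m' n' k' := @mxint_mull R d T P setT measurableT m' n' k'.
rewrite mxint_tr -(mxint_congr measurableT B iYY).
rewrite -(mxint_congr measurableT C iWW).
rewrite -(mull _ _ _ B _ iYW) -(mull _ _ _ C _ iWY).
rewrite -(mxint_mulr measurableT _ (mxintegrable_mull measurableT B iYW)).
rewrite -(mxint_mulr measurableT _ (mxintegrable_mull measurableT C iWY)).
have n2 := mxintegrableN measurableT i2.
have n4 := mxintegrableN measurableT i4.
have i12 := mxintegrableD measurableT i1 n2.
have i34 := mxintegrableD measurableT i3 n4.
have n34 := mxintegrableN measurableT i34.
rewrite -(mxintN measurableT i2) -(mxintN measurableT i4).
rewrite -(mxintD measurableT i3 n4) -(mxintN measurableT i34).
rewrite -(mxintD measurableT i1 n2) -(mxintD measurableT i12 n34).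
apply: eq_mxint => w _; rewrite [(_ - _)^T]linearB /= mulmxBl !mulmxBr.
by rewrite !trmx_mul !trmxK !mulmxA.
Qed.

Lemma enorm_sq (n : nat) (v : 'cV[R]_n) :
  enorm v ^+ 2 = \sum_(a < n) v a ord0 ^+ 2.
Proof. by rewrite sqr_sqrtr// sumr_ge0// => a _; exact: sqr_ge0. Qed.

Lemma measurable_enorm (n : nat) (U : T -> 'cV[R]_n) :
  (forall a, measurable_fun setT (fun w => U w a ord0)) ->
  measurable_fun setT (fun w => enorm (U w)).
Proof.
move=> mU; apply: measurableT_comp.
  by apply: continuous_measurable_fun; exact: sqrt_continuous.
by apply: measurable_sum => a; exact: measurable_funX.
Qed.

Lemma normL_powR (r : R) (n : nat) (U : T -> 'cV[R]_n) : r != 0 ->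
  (normL P r U `^ r = \int[P]_w (enorm (U w) `^ r)%:E)%E.
Proof.
move=> r0; rewrite /normL poweR_Lnorm//; apply: eq_integral => w _ /=.
by rewrite ger0_norm// sqrtr_ge0.
Qed.

(** On a probability space [x^2 <= x^r + 1] reduces the exponent to [2]. *)
Lemma sqvec_normL (r : R) (n : nat) (U : T -> 'cV[R]_n) : 2 <= r ->
  (forall a, measurable_fun setT (fun w => U w a ord0)) ->
  (normL P r U < +oo)%E -> sqvec U.
Proof.
move=> r2 mU Uoo a; split=> //.
have r0 : r != 0 by rewrite gt_eqF// (lt_le_trans _ r2).
have iU : P.-integrable setT (EFin \o (fun w => enorm (U w) `^ r)).
  apply/integrableP; split.
    apply/measurable_EFinP; apply: (measurableT_comp (measurable_powR _)) => //.
    exact: measurable_enorm.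
  under eq_integral do rewrite /= ger0_norm ?powR_ge0//.
  by rewrite -normL_powR//; exact: poweR_lty.
have i1 : P.-integrable setT (EFin \o (fun _ : T => 1 : R)).
  exact: finite_measure_integrable_cst.
apply: integrable_dom (integrableD_EFin iU i1); first exact: measurable_funX.
move=> w /=; rewrite ger0_norm ?sqr_ge0//.
apply: (@le_trans _ _ (enorm (U w) ^+ 2)).
  rewrite enorm_sq (bigD1 a)//= lerDl sumr_ge0// => b _; exact: sqr_ge0.
have e0 : 0 <= enorm (U w) by exact: sqrtr_ge0.
have [e1|e1] := leP (enorm (U w)) 1.
  rewrite (@le_trans _ _ 1)//; last by rewrite lerDr powR_ge0.
  by rewrite expr_le1.
rewrite (@le_trans _ _ (enorm (U w) `^ r))//; last by rewrite lerDl.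
by rewrite -powR_mulrn// ler_powR// ltW.
Qed.

Lemma normL2_le (n : nat) (U : T -> 'cV[R]_n) (c : R) (a : 'I_n) :
  (forall a, measurable_fun setT (fun w => U w a ord0)) ->
  (normL P 2 U <= c%:E)%E -> \int[P]_w (U w a ord0 ^+ 2) <= c ^+ 2.
Proof.
move=> mU Uc.
have c0 : 0 <= c.
  by rewrite -lee_fin; apply: le_trans Uc; exact: Lnorm_ge0.
have sU : sqvec U.
  by apply: (@sqvec_normL 2) => //; exact: le_lt_trans Uc (ltry _).
rewrite -lee_fin /Rintegral fineK; last first.
  by apply: integrable_fin_num => //; exact: (sU a).2.
apply: (@le_trans _ _ (normL P 2 U `^ 2)%E).
  rewrite normL_powR//; apply: ge0_le_integral => //.
  - by move=> w _; rewrite lee_fin sqr_ge0.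
  - by apply/measurable_EFinP; exact: measurable_funX.
  - apply/measurable_EFinP; apply: (measurableT_comp (measurable_powR _)) => //.
    exact: measurable_enorm.
  - move=> w _; rewrite lee_fin powR_mulrn ?sqrtr_ge0// enorm_sq.
    by rewrite (bigD1 a)//= lerDl sumr_ge0// => b _; exact: sqr_ge0.
rewrite (@le_trans _ _ (c%:E `^ 2)%E)//.
  apply: gt0_ler_poweR => //; rewrite in_itv /= leey andbT ?lee_fin ?c0 //.
  exact: Lnorm_ge0.
by rewrite poweR_EFin lee_fin powR_mulrn.
Qed.

(** With increments [D] and [D'] of two coordinates [f] and [g], the increment
    of [f g] is [f D' + D g + D D'].  The bound [|p q| <= h p^2 + q^2 / h] with
    [h = |u - v|] balances the order [h^2] of the mean squares of [D] and [D']
    and leaves a total of order [h]. *)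
Lemma moment_continuous (n : nat) (Y : R -> T -> 'cV[R]_n) (C : R) :
  (forall u : R, 0 <= u <= 1 -> sqvec (Y u)) ->
  (forall (u v : R) a, 0 <= u <= 1 -> 0 <= v <= 1 ->
     \int[P]_w ((Y u w a ord0 - Y v w a ord0) ^+ 2) <= (C * `|u - v|) ^+ 2) ->
  mxcont01 (fun u => Emx P (fun w => Y u w *m (Y u w)^T)).
Proof.
move=> sY LY a b; apply/cont01P => v v01.
pose m c u := \int[P]_w (Y u w c ord0 ^+ 2).
pose K := m a v + m b v + 4 * C ^+ 2.
have m0 c u : 0 <= m c u by apply: Rintegral_ge0 => w _; exact: sqr_ge0.
have K0 : 0 <= K.
  by rewrite /K !addr_ge0// mulr_ge0// sqr_ge0.
have bound (u : R) : 0 <= u <= 1 ->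
    `|Emx P (fun w => Y v w *m (Y v w)^T) a b -
      Emx P (fun w => Y u w *m (Y u w)^T) a b| <= K * `|u - v|.
  move=> u01; have [->|uv] := eqVneq u v.
    by rewrite !subrr !normr0 mulr0.
  set h := `|u - v|; have h0 : 0 < h by rewrite normr_gt0 subr_eq0.
  have h1 : h <= 1.
    by rewrite ler_norml; move: u01 v01 => /andP[? ?] /andP[? ?]; lra.
  pose f w := Y v w a ord0; pose g w := Y v w b ord0.
  pose D w := Y u w a ord0 - f w; pose D' w := Y u w b ord0 - g w.
  have sf : sqint f by exact: sY.
  have sg : sqint g by exact: sY.
  have sD : sqint D by apply: sqintD; [exact: sY|exact: sqintN].
  have sD' : sqint D' by apply: sqintD; [exact: sY|exact: sqintN].
  (* dominates the absolute increment of the product of the coordinates *)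
  pose dom w := (h * f w ^+ 2 + h * g w ^+ 2) +
    ((h^-1 + 1) * D w ^+ 2 + (h^-1 + 1) * D' w ^+ 2).
  have i1 := integrableZ_EFin h sf.2.
  have i2 := integrableZ_EFin h sg.2.
  have i3 := integrableZ_EFin (h^-1 + 1) sD.2.
  have i4 := integrableZ_EFin (h^-1 + 1) sD'.2.
  have iv := gram_integrable (sY _ v01) (sY _ v01).
  have iu := gram_integrable (sY _ u01) (sY _ u01).
  rewrite !EmxE !mxE -RintegralB//.
  have iB := integrableB measurableT (iv a b) (iu a b).
  apply: le_trans (le_normr_Rintegral measurableT iB) _.
  apply: (@le_trans _ _ (\int[P]_w dom w)).
    apply: le_Rintegral => //.
    - by have := integrable_norm iB.
    - by apply: integrableD_EFin; exact: integrableD_EFin.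
    - move=> w _; rewrite !mxE !big_ord1 !mxE /dom.
      have -> : Y v w a ord0 * Y v w b ord0 - Y u w a ord0 * Y u w b ord0 =
          - (f w * D' w + D w * g w + D w * D' w) by rewrite /D /D' /f /g; ring.
      rewrite normrN.
      move: (f w) (g w) (D w) (D' w) => x y s t.
      have E (p q : R) : `|p * q| <= h * p ^+ 2 + h^-1 * q ^+ 2.
        rewrite -[p ^+ 2]real_normK ?num_real// -[q ^+ 2]real_normK ?num_real//.
        rewrite normrM; move: `|p| `|q| => {}p {}q.
        have hv : h * h^-1 = 1 by rewrite mulfV ?gt_eqF.
        have hv0 : 0 < h^-1 by rewrite invr_gt0.
        have : 0 <= h^-1 * (h * p - q) ^+ 2 by rewrite mulr_ge0 ?sqr_ge0 ?ltW.
        have -> : h^-1 * (h * p - q) ^+ 2 =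
          h * h^-1 * (h * p ^+ 2 - 2 * p * q) + h^-1 * q ^+ 2 by ring.
        rewrite hv mul1r => H.
        have : 0 <= h * p ^+ 2 + h^-1 * q ^+ 2.
          by rewrite addr_ge0// mulr_ge0 ?sqr_ge0// ltW.
        by lra.
      have E1 : `|s * t| <= s ^+ 2 + t ^+ 2.
        rewrite normrM -[s ^+ 2]real_normK ?num_real//.
        rewrite -[t ^+ 2]real_normK ?num_real//.
        have := normr_ge0 s; have := normr_ge0 t.
        by move: `|s| `|t| => p q p0 q0; nra.
      have := E x t; have := E y s; rewrite [y * s]mulrC => Ey Ex.
      apply: (le_trans (ler_normD _ _)).
      apply: (le_trans (lerD (ler_normD _ _) E1)).
      by lra.
  have -> : \int[P]_w dom w = h * m a v + h * m b v +
      ((h^-1 + 1) * \int[P]_w (D w ^+ 2) + (h^-1 + 1) * \int[P]_w (D' w ^+ 2)).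
    rewrite RintegralD//; [|exact: integrableD_EFin..].
    rewrite !RintegralD//.
    rewrite !RintegralZl//; [exact: sD'.2|exact: sD.2|exact: sg.2|].
    exact: sf.2.
  have LD : \int[P]_w (D w ^+ 2) <= (C * h) ^+ 2 by exact: LY.
  have LD' : \int[P]_w (D' w ^+ 2) <= (C * h) ^+ 2 by exact: LY.
  have hv0 : 0 < h^-1 + 1 by rewrite addr_gt0// invr_gt0.
  apply: (@le_trans _ _ (h * m a v + h * m b v +
      ((h^-1 + 1) * (C * h) ^+ 2 + (h^-1 + 1) * (C * h) ^+ 2))).
    by rewrite lerD2l lerD// ler_pM2l.
  have -> : h * m a v + h * m b v +
      ((h^-1 + 1) * (C * h) ^+ 2 + (h^-1 + 1) * (C * h) ^+ 2) =
      (m a v + m b v + 2 * C ^+ 2 * (1 + h)) * h.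
    by field; rewrite gt_eqF.
  rewrite ler_pM2r// /K lerD2l.
  have : 0 <= C ^+ 2 * (1 - h) by rewrite mulr_ge0 ?sqr_ge0// subr_ge0.
  by lra.
have vv : (u : R) @[u --> within `[0%R, 1%R]%classic (nbhs v)] --> v.
  exact: cvg_within.
apply/cvgrPdist_le => e e0.
have e1 : 0 < e / (K + 1) by rewrite divr_gt0// ltr_wpDl.
near=> u.
have u01 : 0 <= u <= 1.
  have : `[0%R, 1%R]%classic u by near: u; exact: withinT.
  by rewrite /= in_itv.
apply: le_trans (bound u u01) _.
have ue : `|u - v| <= e / (K + 1).
  by rewrite distrC; near: u; move/cvgrPdist_le : vv => /(_ _ e1).
rewrite (@le_trans _ _ ((K + 1) * (e / (K + 1))))//; last first.
  by rewrite mulrC divfK// gt_eqF// ltr_wpDl.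
by rewrite ler_pM// lerDl.
Unshelve. all: by end_near. Qed.

End Second_moments.

(** * Conditional variance *)

Section Conditional_variance.
Context (R : realType) (d d' : measure_display) (T : measurableType d)
  (T' : measurableType d').
Variable P : probability T R.
Import HBNNSimple.

(** A simple function of [X] weighs finitely many events [X in B]. *)
Lemma integral_nnsfun_comp (X : T -> T') (k : T -> R) (h : {nnsfun T' >-> R}) :
  measurable_fun setT X -> measurable_fun setT k -> (forall w, 0 <= k w) ->
  (\int[P]_w (h (X w) * k w)%:E =
   \sum_(y \in range h)
     (y%:E * \int[P]_(w in X @^-1` (h @^-1` [set y])) (k w)%:E))%E.
Proof.
move=> mX mk k0.
have mY y : measurable (X @^-1` (h @^-1` [set y])).
  by rewrite -[X in measurable X]setTI; apply: mX.
transitivity (\int[P]_w (\sum_(y \in range h)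
    ((y * \1_(h @^-1` [set y]) (X w))%:E * (k w)%:E)))%E.
  apply: eq_integral => w _; rewrite EFinM fimfunE -fsumEFin// ge0_mule_fsuml//.
  by move=> y; exact: nnfun_muleindic_ge0.
have mI y : measurable_fun setT (fun w => \1_(h @^-1` [set y]) (X w) : R).
  by apply: measurableT_comp => //; exact: measurable_indic.
rewrite ge0_integral_fsum//; last 2 first.
- move=> y; apply/measurable_EFinP; apply: measurable_funM => //.
  exact: measurable_funM.
- by move=> y w _; rewrite mule_ge0 ?lee_fin//; exact: nnfun_muleindic_ge0.
apply: eq_fsbigr => y /[!inE] -[x _ hxy].
have y0 : 0 <= y by rewrite -hxy.
under eq_integral do rewrite -EFinM -mulrA EFinM.
rewrite ge0_integralZl_EFin//; last 2 first.
- by move=> w _; rewrite lee_fin mulr_ge0.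
- by apply/measurable_EFinP; exact: measurable_funM.
congr (_ * _)%E; rewrite [RHS]integral_mkcond; apply: eq_integral => w _.
rewrite patchE indicE.
have -> : (X w \in h @^-1` [set y]) = (w \in X @^-1` (h @^-1` [set y])).
  by apply/idP/idP; rewrite !inE.
by case: ifPn => _; rewrite ?mul1r ?mul0r.
Qed.

Lemma integral_comp_lim (X : T -> T') (G : T' -> R) (k : T -> R)
    (mG : measurable_fun setT (EFin \o G)) :
  measurable_fun setT X -> (forall x, 0 <= G x) ->
  measurable_fun setT k -> (forall w, 0 <= k w) ->
  (\int[P]_w (G (X w) * k w)%:E =
   limn (fun n => \int[P]_w (nnsfun_approx measurableT mG n (X w) * k w)%:E))%E.
Proof.
move=> mX G0 mk k0; set h := nnsfun_approx measurableT mG.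
have GE w : (G (X w) * k w)%:E = limn (fun n => (h n (X w) * k w)%:E).
  apply/esym/cvg_lim => //.
  under eq_fun do rewrite EFinM.
  rewrite EFinM; apply: cvgeZr => //.
  by apply: cvg_nnsfun_approx => // x _; rewrite lee_fin.
under eq_integral => w _ do rewrite GE.
apply: monotone_convergence => //.
- move=> n; apply/measurable_EFinP; apply: measurable_funM => //.
  exact: measurableT_comp.
- by move=> n w _; rewrite lee_fin mulr_ge0.
- move=> w _ a b ab; rewrite lee_fin ler_wpM2r//.
  by have /lefP := nd_nnsfun_approx measurableT mG ab; exact.
Qed.

(** If the densities [k] and [l] have the same integral over every event
    generated by [X], they are interchangeable against functions of [X]:
    clear for simple functions, then by monotone convergence. *)
Lemma integral_comp_eq (X : T -> T') (G : T' -> R) (k l : T -> R) :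
  measurable_fun setT X -> measurable_fun setT G -> (forall x, 0 <= G x) ->
  measurable_fun setT k -> (forall w, 0 <= k w) ->
  measurable_fun setT l -> (forall w, 0 <= l w) ->
  (forall B, measurable B ->
    \int[P]_(w in X @^-1` B) (k w)%:E = \int[P]_(w in X @^-1` B) (l w)%:E)%E ->
  (\int[P]_w (G (X w) * k w)%:E = \int[P]_w (G (X w) * l w)%:E)%E.
Proof.
move=> mX mG G0 mk k0 ml l0 kl.
have mG' : measurable_fun setT (EFin \o G) by exact/measurable_EFinP.
rewrite !(integral_comp_lim mG')//; congr (limn _); apply/funext => n.
rewrite !integral_nnsfun_comp//; apply: eq_fsbigr => y _; congr (_ * _)%E.
by apply: kl; exact: measurable_funPTI.
Qed.

Variables (F : set (set T)).
Hypothesis Fm : F `<=` measurable.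

Lemma adapted_measurable (d1 : measure_display) (T1 : measurableType d1)
  (X : T -> T1) : adapted F X -> measurable_fun setT X.
Proof. by move=> aX _ B mB; rewrite setTI; exact/Fm/aX. Qed.

Lemma ge0_integral_eq0_ae (D : set T) (m : T -> R) : measurable D ->
  measurable_fun setT m -> (forall w, D w -> 0 <= m w) ->
  (\int[P]_(w in D) (m w)%:E = 0)%E -> {ae P, forall w, D w -> m w = 0}.
Proof.
move=> mD mm m0 I0.
have : (\int[P]_(w in D) `|(EFin \o m) w| = 0)%E.
  rewrite -I0; apply: eq_integral => w; rewrite inE => /m0 mw /=.
  by rewrite ger0_norm.
move/(ae_eq_integral_abs P mD) => H.
have mm' : measurable_fun D (EFin \o m).
  by apply/measurable_EFinP; exact: measurable_funTS.
by apply: filterS (H mm') => w h Dw; case: (h Dw).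
Qed.

(** Both [m >= 0] and [m <= 0] are events of [F], and [m] integrates to [0]
    over each of them. *)
Lemma condexp0_ae (e m : T -> R) :
  is_condexp P F e (cst 0) -> is_condexp P F e m -> {ae P, forall w, m w = 0}.
Proof.
move=> [_ e0] [am em].
have mm : measurable_fun setT (m : T -> measurableTypeR R).
  exact: adapted_measurable.
have I0 A : F A -> (\int[P]_(w in A) (m w)%:E = 0)%E.
  by move=> FA; rewrite -em// e0//= integral0.
have Fp : F (m @^-1` `[0, +oo[) by apply: am; exact: measurable_itv.
have Fn : F (m @^-1` `]-oo, 0]) by apply: am; exact: measurable_itv.
have p0 : {ae P, forall w, (m @^-1` `[0, +oo[) w -> m w = 0}.
  apply: ge0_integral_eq0_ae (I0 _ Fp) => //; first exact: Fm.
  by move=> w; rewrite /= in_itv /= andbT.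
have n0 : {ae P, forall w, (m @^-1` `]-oo, 0]) w -> - m w = 0}.
  apply: ge0_integral_eq0_ae; first exact: Fm.
  - exact: measurableT_comp.
  - by move=> w; rewrite /= in_itv /= oppr_ge0.
  - have := @integral_ge0N _ _ _ P (m @^-1` `]-oo, 0]) (fun w => (- m w)%:E).
    under eq_integral do rewrite -EFinN opprK.
    rewrite I0// => /(_ _)/esym/eqP; rewrite oppe_eq0 => H; apply/eqP/H.
    by move=> w; rewrite /= in_itv /= lee_fin oppr_ge0.
apply: filterS2 p0 n0 => w h1 h2; have [m0|m0] := leP 0 (m w).
  by apply: h1; rewrite /= in_itv /= m0.
by apply/eqP; rewrite -oppr_eq0; apply/eqP/h2; rewrite /= in_itv /= ltW.
Qed.

(** The conditional variance is centred at some version of the conditional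
    mean, and that version vanishes almost surely. *)
Lemma condvar_integral (e s : T -> R) (A : set T) :
  measurable_fun setT e ->
  is_condexp P F e (cst 0) -> is_condvar P F e s -> F A ->
  (\int[P]_(w in A) (e w ^+ 2)%:E = \int[P]_(w in A) (s w)%:E)%E.
Proof.
move=> me e0 [m em [_ ems]] FA; rewrite -ems//.
have mm : measurable_fun setT (m : T -> measurableTypeR R).
  by apply: adapted_measurable; case: em.
apply: ae_eq_integral => //.
- exact: Fm.
- by apply/measurable_EFinP/measurable_funTS; exact: measurable_funX.
- apply/measurable_EFinP/measurable_funTS; apply: measurable_funX.
  exact: measurable_funB.
- by apply: filterS (condexp0_ae e0 em) => w h _; rewrite h subr0.
Qed.

(** The tower property.  It holds in the extended reals, so it also transfers
    square integrability from [h(X) e] to [h(X) s]. *)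
Lemma condvar_sq (X : T -> T') (h : T' -> R) (e s : T -> R) :
  adapted F X -> measurable_fun setT h ->
  measurable_fun setT e -> measurable_fun setT s ->
  is_condexp P F e (cst 0) -> is_condvar P F e (fun w => s w ^+ 2) ->
  (\int[P]_w ((h (X w) * e w) ^+ 2)%:E =
   \int[P]_w ((h (X w) * s w) ^+ 2)%:E)%E.
Proof.
move=> aX mh me ms e0 es; have mX := adapted_measurable aX.
under eq_integral do rewrite exprMn.
under [RHS]eq_integral do rewrite exprMn.
apply: (@integral_comp_eq X (fun x => h x ^+ 2)) => //.
- exact: measurable_funX.
- by move=> x; exact: sqr_ge0.
- exact: measurable_funX.
- by move=> w; exact: sqr_ge0.
- exact: measurable_funX.
- by move=> w; exact: sqr_ge0.
- by move=> B mB; apply: condvar_integral => //; exact: aX.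
Qed.

Lemma condvar_sqint (X : T -> T') (h : T' -> R) (e s : T -> R) :
  adapted F X -> measurable_fun setT h ->
  measurable_fun setT e -> measurable_fun setT s ->
  is_condexp P F e (cst 0) -> is_condvar P F e (fun w => s w ^+ 2) ->
  sqint P (fun w => h (X w) * e w) -> sqint P (fun w => h (X w) * s w).
Proof.
move=> aX mh me ms e0 es [_ /integrableP[_ he]].
have mX := adapted_measurable aX.
have mhs : measurable_fun setT (fun w => h (X w) * s w).
  by apply: measurable_funM => //; exact: measurableT_comp.
split=> //; apply/integrableP; split.
  by apply/measurable_EFinP; exact: measurable_funX.
under eq_integral do rewrite /= ger0_norm ?sqr_ge0//.
rewrite -(condvar_sq aX mh me ms e0 es).
apply: le_lt_trans he; rewrite le_eqVlt; apply/orP; left; apply/eqP.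
by apply: eq_integral => w _; rewrite /= ger0_norm ?sqr_ge0.
Qed.

(** Off-diagonal entries follow from [condvar_sq] by polarization. *)
Lemma condvar_gram (n : nat) (X : T -> T') (h : T' -> 'cV[R]_n) (e s : T -> R) :
  adapted F X -> (forall a, measurable_fun setT (fun x => h x a ord0)) ->
  measurable_fun setT e -> measurable_fun setT s ->
  is_condexp P F e (cst 0) -> is_condvar P F e (fun w => s w ^+ 2) ->
  sqvec P (fun w => e w *: h (X w)) ->
  sqvec P (fun w => s w *: h (X w)) /\
  Emx P (fun w => (e w *: h (X w)) *m (e w *: h (X w))^T) =
    Emx P (fun w => (s w *: h (X w)) *m (s w *: h (X w))^T).
Proof.
move=> aX mh me ms e0 es sqe.
have sqe' a : sqint P (fun w => h (X w) a ord0 * e w).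
  have := sqe a; rewrite (_ : (fun w => (e w *: h (X w)) a ord0) =
    (fun w => h (X w) a ord0 * e w))//.
  by apply/funext => w; rewrite mxE mulrC.
have sqs' a : sqint P (fun w => h (X w) a ord0 * s w).
  exact: (@condvar_sqint X (fun x => h x a ord0) e).
have sqs : sqvec P (fun w => s w *: h (X w)).
  move=> a; rewrite (_ : (fun w => (s w *: h (X w)) a ord0) =
    (fun w => h (X w) a ord0 * s w))//.
  by apply/funext => w; rewrite mxE mulrC.
split=> //; rewrite !EmxE; apply/matrixP => a b; rewrite !mxE.
pose hp x := h x a ord0 + h x b ord0.
pose hm x := h x a ord0 - h x b ord0.
have mp : measurable_fun setT hp by exact: measurable_funD.
have mm : measurable_fun setT hm by exact: measurable_funB.
have polar (k : T -> R) : (forall c, sqint P (fun w => h (X w) c ord0 * k w)) ->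
    \int[P]_w ((k w *: h (X w)) *m (k w *: h (X w))^T) a b =
    4^-1 * \int[P]_w ((hp (X w) * k w) ^+ 2) +
    - 4^-1 * \int[P]_w ((hm (X w) * k w) ^+ 2).
  move=> sk.
  have [_ ip] : sqint P (fun w => hp (X w) * k w).
    rewrite /hp; under [X in sqint _ X]eq_fun do rewrite mulrDl.
    exact: sqintD.
  have [_ im] : sqint P (fun w => hm (X w) * k w).
    rewrite /hm; under [X in sqint _ X]eq_fun do rewrite mulrBl.
    by apply: sqintD => //; exact: sqintN.
  rewrite -!RintegralZl// -RintegralD//; last 2 first.
  - exact: integrableZ_EFin.
  - exact: integrableZ_EFin.
  apply: eq_Rintegral => w _; rewrite mxE big_ord1 !mxE /hp /hm.
  by field.
rewrite !polar//; congr (_ * fine _ + _ * fine _); exact: condvar_sq.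
Qed.

End Conditional_variance.

(** * Product sigma-algebras and stationarity of the past *)

Section Cylinders.
Context (I : Type) (aT : pointedType) (d : measure_display)
  (rT : measurableType d) (f : I -> aT -> rT).

Lemma measurable_coordinate (i : I) :
  measurable_fun setT (f i : g_sigma_algebraType (cylinders f) -> rT).
Proof.
move=> _ B mB; apply: sub_sigma_algebra; exists i => //; by exists B.
Qed.

Lemma measurable_cylinders (d1 : measure_display) (T1 : measurableType d1)
    (D : set T1) (X : T1 -> aT) : measurable D ->
  (forall i, measurable_fun D (f i \o X)) ->
  measurable_fun D (X : T1 -> g_sigma_algebraType (cylinders f)).
Proof.
move=> mD mX.
apply: (@measurability _ _ _ (g_sigma_algebraType (cylinders f)) _ _
  (cylinders f)) => //.
move=> _ [_ [i _ [B mB <-]] <-].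
by rewrite setTI -comp_preimage; exact: mX.
Qed.

End Cylinders.

Lemma measurable_colcoord (R : realType) (n : nat) (a : 'I_n) :
  measurable_fun setT (fun x : colType R n => x a ord0).
Proof. exact: (@measurable_coordinate _ _ _ _ (@col_coord R n)). Qed.

Lemma measurable_fun_pair_on (d d1 d2 : measure_display)
    (T : measurableType d) (T1 : measurableType d1) (T2 : measurableType d2)
    (D : set T) (f : T -> T1) (g : T -> T2) :
  measurable_fun D f -> measurable_fun D g ->
  measurable_fun D (fun x => (f x, g x)).
Proof.
move=> mf mg mD.
apply: (measurability _ (@measurable_prod_measurableType _ _ T1 T2)) => //.
move=> _ [_ [A mA [B mB <-]] <-].
rewrite (_ : D `&` _ = (D `&` f @^-1` A) `&` (D `&` g @^-1` B)).
  by apply: measurableI; [exact: mf|exact: mg].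
by apply/seteqP; split=> x /=; tauto.
Qed.

Section Stationarity.
Context (R : realType) (d d' : measure_display) (T : measurableType d)
  (E : measurableType d').
Variables (P : probability T R) (xi xi' : int -> T -> E).
Hypothesis inn : innovations P xi xi'.

Lemma measurable_xi (j : int) : measurable_fun setT (xi j).
Proof. by have [m _ _] := inn; exact: (m (false, j)). Qed.

Lemma measurable_past (i : int) :
  measurable_fun setT (past xi i : T -> pathType E).
Proof. by apply: measurable_cylinders => // k; exact: measurable_xi. Qed.

Lemma past_sigma_measurable (i : int) : past_sigma xi i `<=` measurable.
Proof. by move=> _ [B mB <-]; exact: measurable_past. Qed.

(** Finite-dimensional boxes: a pi-system that generates the product
    sigma-algebra.  All but finitely many factors are trivial. *)
Let boxes : set (set (pathType E)) :=
  [set A | exists n (B : nat -> set E),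
     [/\ forall k, measurable (B k), forall k, (n <= k)%N -> B k = setT
       & A = [set x | forall k, B k (x k)]]].

(** Independence and equality of the marginals give a product free of [i]. *)
Lemma past_box (i : int) (n : nat) (B : nat -> set E) :
  (forall k, measurable (B k)) -> (forall k, (n <= k)%N -> B k = setT) ->
  P (past xi i @^-1` [set x | forall k, B k (x k)]) =
    (\prod_(k <- iota 0 n) P (xi 0 @^-1` B k))%E.
Proof.
move=> mB BT; have [_ ind idd] := inn.
pose s := [seq (false, i - k%:Z) | k <- iota 0 n].
(* the coordinate [k] of the past at time [i] is the innovation of index
   [i - k], so [k] is recovered as a distance *)
pose C (b : bool * int) := B `|i - b.2|%N.
have us : uniq s.
  rewrite map_inj_uniq ?iota_uniq// => k l [] /eqP.
  by rewrite (inj_eq (addrI i)) eqr_opp eqz_nat => /eqP.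
have Ck (k : nat) : C (false, i - k%:Z) = B k by rewrite /C/=; congr B; lia.
have := ind s C us (fun b => mB _); rewrite /s big_map => H.
rewrite (_ : past xi i @^-1` _ =
  \bigcap_(b in [set` s]) ((if b.1 then xi' b.2 else xi b.2) @^-1` C b)).
  rewrite H; apply: eq_bigr => k _; rewrite Ck /=.
  exact: (idd (false, i - k%:Z) (false, 0)).
apply/seteqP; split=> [w Bw b /= /mapP[k _ ->]|w Cw k] /=.
  by rewrite Ck; exact: Bw.
have [nk|kn] := leqP n k; first by rewrite BT.
rewrite -Ck; apply: (Cw (false, i - k%:Z)) => /=.
by apply/mapP; exists k => //; rewrite mem_iota.
Qed.

(** The two laws agree on the pi-system of boxes. *)
Lemma past_law (i j : int) (B : set (pathType E)) : measurable B ->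
  P (past xi i @^-1` B) = P (past xi j @^-1` B).
Proof.
have bT : boxes setT.
  exists 0%N, (fun=> setT); split=> //.
  by apply/seteqP; split.
have bI : setI_closed boxes.
  move=> _ _ [n [B1 [m1 T1 ->]]] [m [B2 [m2 T2 ->]]].
  exists (maxn n m), (fun k => B1 k `&` B2 k); split.
  - by move=> k; exact: measurableI.
  - by move=> k; rewrite geq_max => /andP[/T1 -> /T2 ->]; rewrite setIT.
  - apply/seteqP; split=> [x [x1 x2] k|x x12]; first by split.
    by split=> k; have [] := x12 k.
have bm : boxes `<=` measurable.
  move=> _ [n [B1 [m1 T1 ->]]].
  rewrite (_ : [set x | _] =
    \bigcap_k ((fun x : pathType E => x k) @^-1` B1 k)).
    apply: bigcapT_measurable => k; rewrite -[X in measurable X]setTI.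
    exact: (@measurable_coordinate _ _ _ _
      (fun (k : nat) (x : nat -> E) => x k)).
  by apply/seteqP; split=> [x xk k _|x xk k]; [exact: xk|exact: (xk k I)].
have cb : cylinders (fun (k : nat) (x : nat -> E) => x k) `<=` boxes.
  move=> _ [k _ [B1 m1 <-]].
  exists k.+1, (fun l => if l == k then B1 else setT).
  split.
  - by move=> l; case: ifP.
  - by move=> l kl; rewrite gtn_eqF.
  - apply/seteqP; split=> [x [_ xk] l|x xk] /=.
      by case: eqP => [->|].
    by split=> //; have := xk k; rewrite eqxx.
move=> mB.
pose f (l : int) : {mfun T >-> pathType E} :=
  mfun_Sub (mem_set (measurable_past l)).
have Bs : <<s boxes >> B by exact: (sub_sigma_algebra2 cb).
apply: (@g_sigma_algebra_measure_unique _ R (pathType E) boxes bm (fun=> setT)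
  _ _ (pushforward P (f i)) (pushforward P (f j)) bI) Bs => //.
- by apply/seteqP; split=> // x _; exists 0%N.
- move=> _ [n [B1 [m1 T1 ->]]].
  exact: etrans (past_box i m1 T1) (esym (past_box j m1 T1)).
- move=> _; apply: (@le_lt_trans _ _ 1%E); last exact: ltry.
  apply: probability_le1; exact: measurable_funPTI.
Qed.

Lemma past_integral (i j : int) (f : pathType E -> \bar R) :
  measurable_fun setT f -> (forall x, 0 <= f x)%E ->
  (\int[P]_w f (past xi i w) = \int[P]_w f (past xi j w))%E.
Proof.
move=> mf f0.
have H l := @ge0_integral_pushforward _ _ T (pathType E) R _ (measurable_past l)
  P setT f measurableT mf (fun y _ => f0 y).
have := H i; have := H j; rewrite !preimage_setT /comp => <- <-.
apply: eq_measure_integral => [||mj mi B mB _];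
  [exact: measurable_past..|exact: past_law].
Qed.

End Stationarity.

(** * Exchange of expectation and integral *)

Section Fubini_moments.
Context (R : realType) (d : measure_display) (T : measurableType d).
Variables (P : probability T R) (n : nat) (W : R -> T -> 'cV[R]_n).
Let I01 : set (measurableTypeR R) := `[0%R, 1%R]%classic.
Let mI01 : measurable I01. Proof. exact: measurable_itv. Qed.
Let leb : {sigma_finite_measure set (measurableTypeR R) -> \bar R} :=
  @lebesgue_measure R.
Hypothesis mW : forall a,
  measurable_fun (I01 `*` setT)
    (fun z : measurableTypeR R * T => W z.1 z.2 a ord0).
Hypothesis sW : forall u : R, 0 <= u <= 1 -> sqvec P (W u).
Hypothesis cW : mxcont01 (fun u => Emx P (fun w => W u w *m (W u w)^T)).

(** Fubini.  The product of two coordinates is dominated by the sum of their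
    squares, whose expectation is a continuous function of [u]. *)
Lemma Emx_int01 :
  Emx P (fun w => int01 (fun u => W u w *m (W u w)^T)) =
  int01 (fun u => Emx P (fun w => W u w *m (W u w)^T)).
Proof.
rewrite !EmxE int01E; apply/matrixP => a b; rewrite !mxE.
pose f (z : measurableTypeR R * T) : \bar R :=
  (W z.1 z.2 a ord0 * W z.1 z.2 b ord0)%:E.
pose psi := f \_ (I01 `*` setT).
have mD : measurable (I01 `*` [set: T]) by exact: measurableX.
have mpsi : measurable_fun setT psi.
  apply/(measurable_restrictT _ mD)/measurable_EFinP.
  exact: measurable_funM.
have psi1 u w : I01 u -> psi (u, w) = f (u, w).
  by move=> Iu; rewrite /psi patchE mem_set.
have psi0 u w : ~ I01 u -> psi (u, w) = 0%E.
  by move=> Iu; rewrite /psi patchE memNset// => -[].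
have fi (u : R) : 0 <= u <= 1 -> P.-integrable setT (fun w => f (u, w)).
  by move=> u01; exact: sqint_mul (sW u01 a) (sW u01 b).
pose g u := Emx P (fun w => W u w *m (W u w)^T) a a +
  Emx P (fun w => W u w *m (W u w)^T) b b.
have cg : cont01 g by apply: cont01D; exact: cW.
have ig := cont01_integrable cg.
have g0 u : I01 u -> (\int[P]_w `|f (u, w)| <= (g u)%:E)%E.
  rewrite /I01 /= in_itv /= => u01.
  have sa := sW u01 a; have sb := sW u01 b.
  have gE : (g u)%:E = (\int[P]_w (W u w a ord0 ^+ 2 + W u w b ord0 ^+ 2)%:E)%E.
    rewrite /g !EmxE !mxE /Rintegral EFinD !fineK; last 2 first.
    - exact: integrable_fin_num (gram_integrable (sW u01) (sW u01) b b).
    - exact: integrable_fin_num (gram_integrable (sW u01) (sW u01) a a).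
    under [RHS]eq_integral do rewrite EFinD.
    rewrite integralD//; [|exact: sa.2|exact: sb.2].
    by congr (_ + _)%E; apply: eq_integral => w _; rewrite mxE big_ord1 mxE.
  rewrite gE; apply: ge0_le_integral => //.
  - have mf := measurable_int P (fi _ u01).
    exact: (measurableT_comp (@abse_measurable R setT) mf).
  - exact: (measurable_int _ (integrableD_EFin sa.2 sb.2)).
  - move=> w _; rewrite lee_fin /f /= normrM.
    rewrite -[W u w a ord0 ^+ 2]real_normK ?num_real//.
    rewrite -[W u w b ord0 ^+ 2]real_normK ?num_real//.
    have := normr_ge0 (W u w a ord0); have := normr_ge0 (W u w b ord0).
    by move: `|_| `|_| => x y x0 y0; nra.
have ipsi : (leb \x P)%E.-integrable setT psi.
  apply/(integrable12ltyP _ _ mpsi).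
  apply: (@le_lt_trans _ _ (\int[leb]_(u in I01) (g u)%:E)%E).
    rewrite [leRHS]integral_mkcond; apply: ge0_le_integral => //.
    - by move=> u _; exact: integral_ge0.
    - apply: (measurable_fun_fubini_tonelli_F (abse \o psi)) => //=.
      exact: measurableT_comp.
    - by apply/(measurable_restrictT _ mI01); exact: (measurable_int _ ig).
    - move=> u _; rewrite patchE; case: ifPn => [|] /=.
        rewrite inE => Iu; apply: le_trans (g0 u Iu).
        rewrite le_eqVlt; apply/orP; left; apply/eqP.
        by apply: eq_integral => w _; rewrite psi1.
      move=> Iu; rewrite integral0_eq// => w _.
      by rewrite psi0 ?abse0//; move/mem_set; exact/negP.
  exact: integrable_lty ig.
have := @Fubini _ _ _ _ _ leb P psi ipsi.
have -> : (\int[leb]_u \int[P]_w psi (u, w) =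
    \int[leb]_(u in I01) (Emx P (fun w => W u w *m (W u w)^T) a b)%:E)%E.
  rewrite [RHS]integral_mkcond; apply: eq_integral => u _.
  rewrite patchE; case: ifPn => [|Iu].
    rewrite inE => Iu.
    have u01 : 0 <= u <= 1 by move: Iu; rewrite /I01 /= in_itv.
    rewrite EmxE mxE /Rintegral fineK; last first.
      exact: integrable_fin_num (gram_integrable (sW u01) (sW u01) a b).
    by apply: eq_integral => w _; rewrite psi1// /f mxE big_ord1 mxE.
  rewrite integral0_eq// => w _; apply: psi0.
  by move/mem_set; apply/negP.
(* the inner integral is a real number for almost every [w] only; [int01]
   replaces an infinite value by [0] *)
have -> : (\int[P]_w \int[leb]_u psi (u, w) =
    \int[P]_w (int01 (fun u => W u w *m (W u w)^T) a b)%:E)%E.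
  have inner w : (int01 (fun u => W u w *m (W u w)^T) a b) =
      fine (\int[leb]_u psi (u, w)).
    rewrite int01E mxE /Rintegral integral_mkcond; congr fine.
    apply: eq_integral => u _; rewrite /psi !patchE in_setX in_setT andbT.
    by case: ifPn => // _; rewrite /f mxE big_ord1 mxE.
  have mG := measurable_fubini_G ipsi.
  apply: ae_eq_integral => //.
    under eq_fun do rewrite inner.
    by apply/measurable_EFinP; exact: measurableT_comp.
  apply: filterS (ae_integrable2 ipsi) => w iw _; rewrite inner fineK//.
  exact: integrable_fin_num iw.
by move=> H; rewrite /Rintegral -H.
Qed.

End Fubini_moments.

(** * Moments of stationary approximations *)

Lemma unit_interval_ratio (R : realType) (n i : nat) : (i <= n)%N ->
  0 <= (i%:R / n%:R : R) <= 1.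
Proof.
move=> i_n; rewrite divr_ge0//=; case: n i_n => [|n] i_n.
  by rewrite invr0 mulr0.
by rewrite ler_pdivrMr ?ltr0n// mul1r ler_nat.
Qed.

Section Approximation.
Context (R : realType) (d d' : measure_display) (T : measurableType d)
  (E : measurableType d').
Variables (P : probability T R) (xi xi' : int -> T -> E) (n0 : nat).
Hypothesis inn : innovations P xi xi'.
Variables (J : nat -> nat -> (nat -> E) -> 'cV[R]_n0)
  (Js : R -> (nat -> E) -> 'cV[R]_n0).
Hypothesis mJ : forall n i a, (0 < i)%N -> (i <= n)%N ->
  measurable_fun setT (fun s : pathType E => J n i s a ord0).
Hypothesis mJs : forall (u : R) a, 0 <= u <= 1 ->
  measurable_fun setT (fun s : pathType E => Js u s a ord0).

Lemma sqvec_past (i j : int) (f : (nat -> E) -> 'cV[R]_n0) :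
  (forall a, measurable_fun setT (fun s : pathType E => f s a ord0)) ->
  sqvec P (fun w => f (past xi i w)) -> sqvec P (fun w => f (past xi j w)).
Proof.
move=> mf sf a; have [_ /integrableP[_ fi]] := sf a.
have mfj : measurable_fun setT (fun w => f (past xi j w) a ord0).
  exact: measurableT_comp (mf a) (measurable_past inn j).
split=> //; apply/integrableP; split.
  by apply/measurable_EFinP; exact: measurable_funX.
have := @past_integral _ _ _ _ _ P xi xi' inn j i
  (fun s => `|(f s a ord0 ^+ 2)%:E|%E) => /= -> //.
apply/measurable_EFinP; apply: measurableT_comp => //.
exact: measurable_funX.
Qed.

Hypothesis moment : exists2 r : R, 2 <= r & (moment_sup P xi J r < +oo)%E.
Hypothesis approx : exists K : R, \forall n \near \oo, forall i : nat,
  (0 < i)%N -> (i <= n)%N ->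
  (normL P 2 (fun w => (J n i (past xi i%:Z w) -
     Js (i%:R / n%:R) (past xi i%:Z w))%R) <= (K / n%:R)%:E)%E.
Variable C : R.
Hypothesis lip : forall (i : int) (u v : R), 0 <= u <= 1 -> 0 <= v <= 1 ->
  (normL P 2 (fun w => (Js u (past xi i w) - Js v (past xi i w))%R) <=
    (C * `|u - v|)%:E)%E.

Let mJsB (i : int) (u v : R) a : 0 <= u <= 1 -> 0 <= v <= 1 ->
  measurable_fun setT
    (fun w => (Js u (past xi i w) - Js v (past xi i w)) a ord0).
Proof.
move=> u01 v01; under eq_fun do rewrite !mxE.
apply: measurable_funB.
  exact: measurableT_comp (mJs a u01) (measurable_past inn i).
exact: measurableT_comp (mJs a v01) (measurable_past inn i).
Qed.

(** The array has a moment of order [r >= 2] at time [0], hence at every time;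
    for one large [n] its approximation [Js (1 / n)] inherits it, and the
    Lipschitz condition carries it over to every other [u]. *)
Lemma approx_sqvec (i : int) (u : R) : 0 <= u <= 1 ->
  sqvec P (fun w => Js u (past xi i w)).
Proof.
move=> u01; apply: (@sqvec_past 1%:Z) => [a|]; first exact: mJs.
have [r r2 rfin] := moment; have [K [N _ HN]] := approx.
pose n := N.+1; have n1 : (1 <= n)%N by [].
have sJ : sqvec P (fun w => J n 1%N (past xi 1%:Z w)).
  apply: (@sqvec_past 0) => [a|]; first exact: mJ.
  apply: (@sqvec_normL _ _ _ _ r) => // [a|].
    exact: measurableT_comp (@mJ n 1%N a isT n1) (measurable_past inn 0).
  apply: le_lt_trans rfin; apply: ereal_sup_ubound.
  by exists n, 1%N.
have v01 := @unit_interval_ratio R n 1%N n1; set v : R := 1%:R / n%:R in v01.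
have sB : sqvec P (fun w => J n 1%N (past xi 1%:Z w) - Js v (past xi 1%:Z w)).
  apply: (@sqvec_normL _ _ _ _ 2) => // [a|].
    under eq_fun do rewrite !mxE; apply: measurable_funB.
      exact: measurableT_comp (@mJ n 1%N a isT n1) (measurable_past inn 1).
    exact: measurableT_comp (mJs a v01) (measurable_past inn 1).
  by apply: le_lt_trans (HN n _ 1%N _ _) _ => //=; rewrite ?leqnSn ?ltry.
have sv := sqvecB sJ sB.
have sL : sqvec P (fun w => Js v (past xi 1%:Z w) - Js u (past xi 1%:Z w)).
  apply: (@sqvec_normL _ _ _ _ 2) => // [a|]; first exact: mJsB.
  by apply: le_lt_trans (lip _ _ _) _ => //; rewrite ltry.
move=> a; have := sqvecB sv sL a.
congr (sqint P _); apply/funext => w; congr (fun_of_matrix _ _ _).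
by rewrite !subKr.
Qed.

Lemma approx_continuous (i : int) :
  mxcont01 (fun u => Emx P (fun w =>
    Js u (past xi i w) *m (Js u (past xi i w))^T)).
Proof.
apply: (@moment_continuous _ _ _ P n0 (fun u w => Js u (past xi i w)) C).
  by move=> u; exact: approx_sqvec.
move=> u v a u01 v01.
have := normL2_le a (fun b => mJsB i b u01 v01) (lip i u01 v01).
by under eq_Rintegral do rewrite !mxE.
Qed.

End Approximation.

(** * Moments in the regression model *)

Section Unit_interval_sections.
Context (R : realType) (d d' d'' : measure_display) (T : measurableType d)
  (S : measurableType d') (Z : measurableType d'').

Lemma stripE : [set z : measurableTypeR R * T | 0 <= z.1 <= 1] =
  (`[0%R, 1%R]%classic : set (measurableTypeR R)) `*` setT.
Proof. by apply/seteqP; split=> -[u w] /=; rewrite in_itv /=; [|case]. Qed.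

Lemma measurable_strip :
  measurable [set z : measurableTypeR R * T | 0 <= z.1 <= 1].
Proof. by rewrite stripE; apply: measurableX => //; exact: measurable_itv. Qed.

Lemma measurable_section (f : measurableTypeR R * T -> S) (u : R) :
  measurable_fun [set z : measurableTypeR R * T | 0 <= z.1 <= 1] f ->
  0 <= u <= 1 -> measurable_fun setT (fun x : T => f (u, x)).
Proof.
move=> mf u01; apply: (measurable_comp measurable_strip _ mf).
  by move=> _ [x _ <-].
exact: pair1_measurable.
Qed.

Lemma measurable_strip_comp (f : measurableTypeR R * T -> S)
    (g : measurableTypeR R * Z -> T) :
  measurable_fun [set z : measurableTypeR R * T | 0 <= z.1 <= 1] f ->
  measurable_fun [set z : measurableTypeR R * Z | 0 <= z.1 <= 1] g ->
  measurable_fun [set z : measurableTypeR R * Z | 0 <= z.1 <= 1]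
    (fun z => f (z.1, g z)).
Proof.
move=> mf mg; apply: (measurable_comp measurable_strip _ mf).
  by move=> _ [z z01 <-].
by apply: measurable_fun_pair_on => //; exact: measurable_funTS.
Qed.

Lemma measurable_scale (n : nat) (c : T -> R) (v : T -> 'cV[R]_n) (a : 'I_n) :
  measurable_fun setT c -> measurable_fun setT (fun x => v x a ord0) ->
  measurable_fun setT (fun x => (c x *: v x) a ord0).
Proof.
by move=> mc mv; under eq_fun do rewrite mxE; exact: measurable_funM.
Qed.

End Unit_interval_sections.

Section Model.
Context (R : realType) (d d' : measure_display) (T : measurableType d)
  (E : measurableType d') (p1 p2 : nat).
Variables (P : probability T R) (M : regression R T E p1 p2).
Hypothesis inn : innovations P (xi M) (xi' M).
Hypothesis rm : regression_model P M.
Hypothesis sa : stationary_approximation P M.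

Lemma measurable_Gs (u : R) : 0 <= u <= 1 ->
  measurable_fun setT (Gs M u : pathType E -> colType R (p1 + p2)).
Proof. by move=> u01; have [mG _] := sa; exact: measurable_section mG u01. Qed.

Lemma measurable_xs (i : int) (u : R) : 0 <= u <= 1 ->
  measurable_fun setT (xs M i u : T -> colType R (p1 + p2)).
Proof.
move=> u01.
exact: measurableT_comp (measurable_Gs u01) (measurable_past inn i).
Qed.

Lemma measurable_sigma (u : R) : 0 <= u <= 1 ->
  measurable_fun setT (sigma M u : colType R (p1 + p2) -> measurableTypeR R).
Proof.
by move=> u01; have [_ _ ms _] := rm; exact: measurable_section ms u01.
Qed.

Lemma measurable_sigmas (i : int) (u : R) : 0 <= u <= 1 ->
  measurable_fun setT (sigmas M i u).
Proof.
move=> u01.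
exact: measurableT_comp (measurable_sigma u01) (measurable_xs i u01).
Qed.

Lemma sigma_gt0 (u : R) x : 0 <= u <= 1 -> 0 < sigma M u x.
Proof. by move=> u01; have [_ s0 _ _] := rm; exact: s0. Qed.

Section Weight.
Variable p : R -> 'cV[R]_(p1 + p2) -> R.
Hypothesis wp : weighted_assumptions P M p.

Let Xs (u : R) (s : nat -> E) := p u (Gs M u s) *: Gs M u s.
Let Xes (u : R) (s : nat -> E) := (p u (Gs M u s) * Hs M u s) *: Xs u s.

Let mp (u : R) : 0 <= u <= 1 ->
  measurable_fun setT (p u : colType R (p1 + p2) -> measurableTypeR R).
Proof. by have [+ _ _ _] := wp; exact. Qed.

Let mG (n i : nat) : (0 < i)%N -> (i <= n)%N ->
  measurable_fun setT (Gn M n i : pathType E -> colType R (p1 + p2)).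
Proof. by move=> i0 i_n; have [_ _ _ /(_ n i i0 i_n)[]] := rm. Qed.

Let mH (n i : nat) : (0 < i)%N -> (i <= n)%N ->
  measurable_fun setT (Hn M n i : pathType E -> measurableTypeR R).
Proof. by move=> i0 i_n; have [_ _ _ /(_ n i i0 i_n)[]] := rm. Qed.

Let mHs (u : R) : 0 <= u <= 1 ->
  measurable_fun setT (Hs M u : pathType E -> measurableTypeR R).
Proof. by move=> u01; have [_ /(_ u u01)[]] := sa. Qed.

Let mX (n i : nat) a : (0 < i)%N -> (i <= n)%N ->
  measurable_fun setT (fun s : pathType E => wX_fun M p n i s a ord0).
Proof.
move=> i0 i_n; have u01 := @unit_interval_ratio R n i i_n.
apply: measurable_scale.
  exact: measurableT_comp (mp u01) (mG i0 i_n).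
exact: measurableT_comp (measurable_colcoord a) (mG i0 i_n).
Qed.

Let mXe (n i : nat) a : (0 < i)%N -> (i <= n)%N ->
  measurable_fun setT (fun s : pathType E => wXeps_fun M p n i s a ord0).
Proof.
move=> i0 i_n; have u01 := @unit_interval_ratio R n i i_n.
apply: measurable_scale; last exact: mX.
apply: measurable_funM; last exact: mH.
exact: measurableT_comp (mp u01) (mG i0 i_n).
Qed.

Let mXs (u : R) a : 0 <= u <= 1 ->
  measurable_fun setT (fun s : pathType E => Xs u s a ord0).
Proof.
move=> u01; apply: measurable_scale.
  exact: measurableT_comp (mp u01) (measurable_Gs u01).
exact: measurableT_comp (measurable_colcoord a) (measurable_Gs u01).
Qed.

Let mXes (u : R) a : 0 <= u <= 1 ->
  measurable_fun setT (fun s : pathType E => Xes u s a ord0).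
Proof.
move=> u01; apply: measurable_scale; last exact: mXs.
apply: measurable_funM; last exact: mHs.
exact: measurableT_comp (mp u01) (measurable_Gs u01).
Qed.

Lemma weighted_regressor_moments (i : int) :
  (forall u : R, 0 <= u <= 1 -> sqvec P (wXs M p i u)) /\
  mxcont01 (fun u => Emx P (fun w => wXs M p i u w *m (wXs M p i u w)^T)).
Proof.
have [_ [[K HK] [C _ HC]] [q [q1 [q2 [_ q1l _ _ [[_ mom] _]]]]] _] := wp.
have moment : exists2 r : R, 2 <= r &
    (moment_sup P (xi M) (wX_fun M p) r < +oo)%E.
  by exists (2 * q1) => //; move: q1l; lra.
have approx : exists K : R, \forall n \near \oo, forall i : nat,
    (0 < i)%N -> (i <= n)%N ->
    (normL P 2 (fun w => (wX_fun M p n i (past (xi M) i%:Z w) -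
       Xs (i%:R / n%:R) (past (xi M) i%:Z w))%R) <= (K / n%:R)%:E)%E.
  exists K; apply: filterS HK => n HK j j0 jn; apply: le_trans (HK j j0 jn).
  by apply: leeDl; exact: Lnorm_ge0.
have lip (j : int) (u v : R) : 0 <= u <= 1 -> 0 <= v <= 1 ->
    (normL P 2 (fun w => (Xs u (past (xi M) j w) - Xs v (past (xi M) j w))%R) <=
      (C * `|u - v|)%:E)%E.
  move=> u01 v01; apply: le_trans (HC j u v u01 v01).
  by apply: leeDl; exact: Lnorm_ge0.
split=> [u u01|].
  exact: (approx_sqvec inn mX mXs moment approx lip i u01).
exact: (approx_continuous inn mX mXs moment approx lip).
Qed.

Lemma weighted_score_moments (i : int) :
  (forall u : R, 0 <= u <= 1 -> sqvec P (wXepss M p i u)) /\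
  mxcont01 (fun u =>
    Emx P (fun w => wXepss M p i u w *m (wXepss M p i u w)^T)).
Proof.
have [_ [[K HK] [C _ HC]] [q [q1 [q2 [_ _ q2l _ [_ [_ mom]]]]]] _] := wp.
have moment : exists2 r : R, 2 <= r &
    (moment_sup P (xi M) (wXeps_fun M p) r < +oo)%E.
  by exists q2 => //; exact: ltW.
have approx : exists K : R, \forall n \near \oo, forall i : nat,
    (0 < i)%N -> (i <= n)%N ->
    (normL P 2 (fun w => (wXeps_fun M p n i (past (xi M) i%:Z w) -
       Xes (i%:R / n%:R) (past (xi M) i%:Z w))%R) <= (K / n%:R)%:E)%E.
  exists K; apply: filterS HK => n HK j j0 jn; apply: le_trans (HK j j0 jn).
  by apply: leeDr; exact: Lnorm_ge0.
have lip (j : int) (u v : R) : 0 <= u <= 1 -> 0 <= v <= 1 ->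
    (normL P 2
      (fun w => (Xes u (past (xi M) j w) - Xes v (past (xi M) j w))%R) <=
      (C * `|u - v|)%:E)%E.
  move=> u01 v01; apply: le_trans (HC j u v u01 v01).
  by apply: leeDr; exact: Lnorm_ge0.
split=> [u u01|].
  exact: (approx_sqvec inn mXe mXes moment approx lip i u01).
exact: (approx_continuous inn mXe mXes moment approx lip).
Qed.

Lemma S1E (i : int) (u : R) :
  S1 P M p i u = Emx P (fun w => wXs M p i u w *m (wXs M p i u w)^T).
Proof.
rewrite /S1; congr Emx; apply/funext => w; rewrite /wXs.
by rewrite linearZ /= -scalemxAl -scalemxAr scalerA.
Qed.

Lemma posdef_S1 (i : int) (u : R) : 0 <= u <= 1 -> posdef (S1 P M p i u).
Proof.
move=> u01; rewrite S1E; apply: nonneg_definite_posdef.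
  by apply: gram_nonneg; exact: (weighted_regressor_moments i).1.
by have [_ _ _ +] := wp; exact.
Qed.

Lemma mxcont01_S1 (i : int) : mxcont01 (S1 P M p i).
Proof.
rewrite (_ : S1 P M p i = fun u =>
  Emx P (fun w => wXs M p i u w *m (wXs M p i u w)^T)).
  exact: (weighted_regressor_moments i).2.
by apply/funext => u; exact: S1E.
Qed.

(** The counterpart of [X eps] that has [sigma] in place of [e]. *)
Let Y (i : int) (u : R) (w : T) :=
  sigmas M i u w *: (p u (xs M i u w) ^+ 2 *: xs M i u w).

Lemma S2E (i : int) (u : R) :
  S2 P M p i u = Emx P (fun w => Y i u w *m (Y i u w)^T).
Proof.
rewrite /S2; congr Emx; apply/funext => w; rewrite /Y !scalerA.
rewrite linearZ /= -scalemxAl -scalemxAr scalerA; congr (_ *: _); ring.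
Qed.

(** The moment assumptions bear on [X eps = p^2 e x]; conditioning replaces
    [e^2] by [sigma^2] in its second moments. *)
Lemma Y_gram (i : int) (u : R) : 0 <= u <= 1 ->
  sqvec P (Y i u) /\ S2 P M p i u =
    Emx P (fun w => wXepss M p i u w *m (wXepss M p i u w)^T).
Proof.
move=> u01; have [_ /(_ u u01)[_ /(_ i)[ax _ e0 ev]]] := sa.
pose h (x : colType R (p1 + p2)) : 'cV[R]_(p1 + p2) := p u x ^+ 2 *: x.
have eY : wXepss M p i u = fun w => es M i u w *: h (xs M i u w).
  by apply/funext => w; rewrite /wXepss /wXs /h !scalerA; congr (_ *: _); ring.
have me : measurable_fun setT (es M i u).
  exact: measurableT_comp (mHs u01) (measurable_past inn i).
have mh a : measurable_fun setT (fun x => h x a ord0).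
  apply: measurable_scale; last exact: measurable_colcoord.
  by apply: measurable_funX; exact: mp.
have := condvar_gram (@past_sigma_measurable _ _ _ _ _ P _ _ inn (i - 1))
  ax mh me (measurable_sigmas i u01) e0 ev.
rewrite S2E eY => H; have := (weighted_score_moments i).1 u u01.
by rewrite eY => /H [sY ->].
Qed.

Lemma mxcont01_S2 (i : int) : mxcont01 (S2 P M p i).
Proof.
move=> a b; have := (weighted_score_moments i).2 a b.
by apply: cont01_eq => u u01; have [_ ->] := Y_gram i u01.
Qed.

End Weight.

Lemma sigma_inv_sq (i : int) (u : R) (w : T) :
  (sigmas M i u w ^+ 2)^-1 = (sigma M u (xs M i u w))^-1 ^+ 2.
Proof. by rewrite exprVn. Qed.

Notation optimal := (fun u x => (sigma M u x)^-1).

Lemma S_starE (i : int) : S_star P M i = S1 P M optimal i.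
Proof.
apply/funext => u; rewrite /S_star /S1; congr Emx; apply/funext => w.
by rewrite sigma_inv_sq.
Qed.

(** The inverse of [sigma] is written as a power with exponent [-1], which is
    measurable in its base and agrees with the inverse since [sigma > 0]. *)
Lemma measurable_optimal_regressor (i : int) a :
  measurable_fun [set z : measurableTypeR R * T | 0 <= z.1 <= 1]
    (fun z => wXs M optimal i z.1 z.2 a ord0).
Proof.
have [mG _] := sa; have [_ _ ms _] := rm.
have mD := @measurable_strip R d T.
have mx : measurable_fun [set z : measurableTypeR R * T | 0 <= z.1 <= 1]
    (fun z => xs M i z.1 z.2 : colType R (p1 + p2)).
  apply: (measurable_strip_comp mG); apply: measurable_funTS.
  exact: measurableT_comp (measurable_past inn i) measurable_snd.
have mxa := measurableT_comp (measurable_colcoord a) mx.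
have msx := measurable_strip_comp ms mx.
apply: (@eq_measurable_fun _ _ _ _ _
  (fun z : measurableTypeR R * T => (sigma M z.1 (xs M i z.1 z.2)) `^ (-1) *
     xs M i z.1 z.2 a ord0)).
  move=> [u w]; rewrite inE /= => u01.
  by rewrite /wXs mxE powR_inv1// ltW// sigma_gt0.
apply: measurable_funM => //.
exact: measurableT_comp (measurable_powR (-1)) msx.
Qed.

End Model.

(** * The weighted estimator and the optimal weight *)

Section Sandwich_bound.
Context (R : realType) (d d' : measure_display) (T : measurableType d)
  (E : measurableType d') (p1 p2 : nat).
Variables (P : probability T R) (M : regression R T E p1 p2).
Variable p : R -> 'cV[R]_(p1 + p2) -> R.
Notation optimal := (fun u x => (sigma M u x)^-1).
Hypothesis inn : innovations P (xi M) (xi' M).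
Hypothesis rm : regression_model P M.
Hypothesis sa : stationary_approximation P M.
Hypothesis wp : weighted_assumptions P M p.
Hypothesis ws : weighted_assumptions P M optimal.
Variable i : int.

(** With [Y = p^2 sigma x] and [W = x / sigma], the moments are [E[Y Y'] = S2],
    [E[Y W'] = S1] and [E[W W'] = S*], so that the difference of the two sides
    is the second moment matrix of [S1^-1 Y - S*^-1 W]. *)
Lemma sandwich_ge_S_star_inv (u : R) : 0 <= u <= 1 ->
  loewner_le (invmx (S_star P M i u))
    (invmx (S1 P M p i u) *m S2 P M p i u *m invmx (S1 P M p i u)).
Proof.
move=> u01; rewrite S_starE.
have [sY _] := Y_gram inn rm sa wp i u01.
have sW := (weighted_regressor_moments inn rm sa ws i).1 u u01.
have pd1 := posdef_S1 inn rm sa wp i u01.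
have pds := posdef_S1 inn rm sa ws i u01.
have u1 := posdef_unitmx pd1; have us := posdef_unitmx pds.
set B := invmx (S1 P M p i u); set C := invmx (S1 P M optimal i u).
have Bt : B^T = B by apply: invmx_sym; case: pd1.
have Ct : C^T = C by apply: invmx_sym; case: pds.
rewrite /loewner_le.
have YW : Emx P (fun w =>
    (sigmas M i u w *: (p u (xs M i u w) ^+ 2 *: xs M i u w)) *m
      (wXs M optimal i u w)^T) = S1 P M p i u.
  congr Emx; apply/funext => w; rewrite /wXs /= [(_ *: xs _ _ _ _)^T]linearZ /=.
  rewrite -scalemxAr -!scalemxAl.
  rewrite !scalerA; congr (_ *: _).
  by rewrite mulVf ?mul1r// gt_eqF// (sigma_gt0 rm).
have := gramB B C sY sW; rewrite YW -S2E -S1E Bt Ct.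
have -> : (S1 P M p i u)^T = S1 P M p i u by case: pd1.
rewrite [B *m S1 _ _ _ _ _]mulVmx// mul1mx -[C *m S1 _ _ p _ _ *m B]mulmxA.
rewrite [S1 _ _ p _ _ *m B]mulmxV// mulmx1 [C *m S1 _ _ _ _ _]mulVmx// mul1mx.
rewrite subrr subr0 => <-; apply: gram_nonneg.
by apply: sqvecB; exact: sqvec_mull.
Qed.

Let A := first_coords R p1 p2.
Let I01 : set R := `[0%R, 1%R]%classic.
Let mI01 : measurable (I01 : set (measurableTypeR R)).
Proof. exact: measurable_itv. Qed.

Lemma mxcont01_S_star_inv : mxcont01 (fun u => invmx (S_star P M i u)).
Proof.
rewrite S_starE; apply: mxcont01_inv; last exact: mxcont01_S1.
by move=> u u01; apply: posdef_unitmx; exact: posdef_S1.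
Qed.

Lemma sandwich_bound :
  loewner_le
    (int01 (fun u => A *m invmx (S_star P M i u) *m A^T))
    (int01 (fun u => A *m invmx (S1 P M p i u) *m S2 P M p i u
                       *m invmx (S1 P M p i u) *m A^T)).
Proof.
have cS := mxcont01_S_star_inv.
have cB : mxcont01 (fun u => invmx (S1 P M p i u)).
  apply: mxcont01_inv; last exact: mxcont01_S1.
  by move=> u u01; apply: posdef_unitmx; exact: posdef_S1.
have cS2 : mxcont01 (S2 P M p i) by exact: mxcont01_S2.
have cA (m n : nat) (L : 'M[R]_(m, n)) : mxcont01 (fun=> L).
  exact: mxcont01_cst.
have iU : mxintegrable lebesgue_measure I01
    (fun u => A *m invmx (S_star P M i u) *m A^T).
  by apply: mxcont01_integrable; do 2 apply: mxcont01M => //.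
have iV : mxintegrable lebesgue_measure I01
    (fun u => A *m invmx (S1 P M p i u) *m S2 P M p i u
                       *m invmx (S1 P M p i u) *m A^T).
  by apply: mxcont01_integrable; do 4 apply: mxcont01M => //.
have nU := mxintegrableN mI01 iU.
rewrite /loewner_le !int01E -(mxintN mI01 iU) -(mxintD mI01 iV nU).
apply: nonneg_definite_mxint => //; first exact: mxintegrableD.
move=> u; rewrite /I01 /= in_itv /= => u01.
have := nonneg_definite_congr A (sandwich_ge_S_star_inv u01).
by rewrite mulmxBr mulmxBl !mulmxA.
Qed.

End Sandwich_bound.

(** * Averaged and partial regression *)

Section Partial_regression_bound.
Context (R : realType) (d d' : measure_display) (T : measurableType d)
  (E : measurableType d') (p1 p2 : nat).
Variables (P : probability T R) (M : regression R T E p1 p2).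
Notation optimal := (fun u x => (sigma M u x)^-1).
Hypothesis inn : innovations P (xi M) (xi' M).
Hypothesis rm : regression_model P M.
Hypothesis sa : stationary_approximation P M.
Hypothesis ws : weighted_assumptions P M optimal.
Variable i : int.
Let A := first_coords R p1 p2.
Let I01 : set R := `[0%R, 1%R]%classic.
Let mI01 : measurable (I01 : set (measurableTypeR R)).
Proof. exact: measurable_itv. Qed.

(** The matrix that maps [x] to [x1 - q2*' x2]. *)
Definition partial_out (u : R) : 'M[R]_(p1, p1 + p2) :=
  first_coords R p1 p2 - (q2_star P M i u)^T *m row_mx 0 1%:M.
Let K := partial_out.

Lemma posdef_S_star (u : R) : 0 <= u <= 1 -> posdef (S_star P M i u).
Proof. by move=> u01; rewrite S_starE; exact: posdef_S1. Qed.

Lemma mxcont01_S_star : mxcont01 (S_star P M i).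
Proof. by rewrite S_starE; exact: mxcont01_S1. Qed.

Lemma q2_starE (u : R) : q2_star P M i u =
  invmx (drsubmx (S_star P M i u)) *m dlsubmx (S_star P M i u).
Proof.
rewrite /q2_star; congr (invmx _ *m _); apply/matrixP => a b; rewrite !mxE;
  congr (fine 'E_P[_]); apply/funext => w; rewrite !mxE !big_ord1 !mxE //.
Qed.

Lemma mxcont01_partial_out : mxcont01 K.
Proof.
have cS := mxcont01_S_star.
apply: mxcont01B; first exact: mxcont01_cst.
apply: mxcont01M; last exact: mxcont01_cst.
apply: mxcont01_tr.
rewrite (_ : q2_star P M i = fun u =>
  invmx (drsubmx (S_star P M i u)) *m dlsubmx (S_star P M i u)); last first.
  by apply/funext => u; exact: q2_starE.
apply: mxcont01M; last exact: mxcont01_dlsub.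
apply: mxcont01_inv; last exact: mxcont01_drsub.
move=> u u01; rewrite dr_block_congr; apply: posdef_unitmx.
apply: (posdef_congr (L := col_mx 0 1%:M)); last exact: posdef_S_star.
by rewrite mul_row_col mul0mx mul1mx add0r.
Qed.

Lemma partial_out_first (u : R) : K u *m A^T = 1%:M.
Proof.
rewrite /K /partial_out /A /first_coords mulmxBl -mulmxA tr_row_mx trmx1 trmx0.
by rewrite !mul_row_col !mul1mx mulmx0 !mul0mx !addr0 mulmx0 subr0.
Qed.

Lemma x1_tildeE (u : R) (w : T) : x1_tilde P M i u w = K u *m xs M i u w.
Proof.
rewrite /x1_tilde /K /partial_out /first_coords /xs1 /xs2 mulmxBl -mulmxA.
rewrite -[in RHS](vsubmxK (xs M i u w)) !mul_row_col !mul0mx !mul1mx.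
by rewrite addr0 add0r.
Qed.

Let Sigma u := K u *m S_star P M i u *m (K u)^T.

Lemma mxcont01_Sigma : mxcont01 Sigma.
Proof.
have cK := mxcont01_partial_out.
apply: mxcont01M; last exact: mxcont01_tr.
by apply: mxcont01M => //; exact: mxcont01_S_star.
Qed.

Lemma posdef_Sigma (u : R) : 0 <= u <= 1 -> posdef (Sigma u).
Proof.
by move=> u01; exact: posdef_congr (partial_out_first u) (posdef_S_star u01).
Qed.

(** By [Emx_int01] for the process [K x / sigma], whose second moment matrix at
    [u] is [Sigma u]. *)
Lemma Sigma_starE : Sigma_star P M i = int01 Sigma.
Proof.
pose V u w := K u *m wXs M optimal i u w.
have sW := (weighted_regressor_moments inn rm sa ws i).1.
have VE (u : R) : 0 <= u <= 1 -> Emx P (fun w => V u w *m (V u w)^T) = Sigma u.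
  by move=> u01; rewrite gram_mull -?S1E ?/Sigma ?S_starE//; exact: sW.
have -> : Sigma_star P M i =
    Emx P (fun w => int01 (fun u => V u w *m (V u w)^T)).
  congr Emx; apply/funext => w; congr int01; apply/funext => u.
  rewrite sigma_inv_sq x1_tildeE /V /wXs -scalemxAr.
  by rewrite [(_ *: (K u *m _))^T]linearZ /= -scalemxAl -scalemxAr scalerA.
rewrite Emx_int01.
- apply: eq_mxint => u /=; rewrite in_itv /= => u01; exact: VE.
- move=> a; rewrite -stripE.
  apply: (@eq_measurable_fun _ _ _ _ _ (fun z : measurableTypeR R * T =>
      \sum_b K z.1 a b * wXs M optimal i z.1 z.2 b ord0)).
    by move=> z _; rewrite /V mxE.
  apply: measurable_sum => b; apply: measurable_funM; last first.
    exact: (measurable_optimal_regressor inn rm sa i b).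
  have mK := cont01_measurable (@mxcont01_partial_out a b).
  apply: (@measurable_comp _ _ _ _ _ _ _ (fun u => K u a b) _ fst mI01 _ mK).
    by move=> _ [z z01 <-]; rewrite /I01 /= in_itv.
  by apply: measurable_funTS; exact: measurable_fst.
- by move=> u u01; apply: sqvec_mull; exact: sW.
- move=> a b; have := @mxcont01_Sigma a b.
  by apply: cont01_eq => u u01; rewrite VE.
Qed.

Lemma posdef_Sigma_star : posdef (Sigma_star P M i).
Proof.
by rewrite Sigma_starE; apply: posdef_int01;
  [exact: mxcont01_Sigma|exact: posdef_Sigma].
Qed.

(** Integrating [square_completion] with [B] the inverse of [Sigma_star] turns
    [B Sigma B' - 2 B] into [- B]. *)
Lemma partial_regression_bound :
  loewner_le (invmx (Sigma_star P M i))
    (int01 (fun u => A *m invmx (S_star P M i u) *m A^T)).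
Proof.
have pS := posdef_Sigma_star; set B := invmx _.
have Bt : B^T = B by apply: invmx_sym; case: pS.
have iS : mxintegrable lebesgue_measure I01
    (fun u => A *m invmx (S_star P M i u) *m A^T).
  apply: mxcont01_integrable; apply: mxcont01M; last exact: mxcont01_cst.
  by apply: mxcont01M; [exact: mxcont01_cst|exact: mxcont01_S_star_inv].
have iSigma : mxintegrable lebesgue_measure I01 Sigma.
  exact/mxcont01_integrable/mxcont01_Sigma.
have iB : mxintegrable lebesgue_measure I01 (fun=> B + B).
  exact/mxcont01_integrable/mxcont01_cst.
have nB := mxintegrableN mI01 iB.
have iBS := mxintegrable_congr mI01 B iSigma.
have i2 := mxintegrableD mI01 iBS nB.
rewrite /loewner_le.
have -> : int01 (fun u => A *m invmx (S_star P M i u) *m A^T) - B =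
  mxint lebesgue_measure I01 (fun u => A *m invmx (S_star P M i u) *m A^T +
    (B *m Sigma u *m B^T - (B + B))).
  rewrite (mxintD mI01 iS i2) (mxintD mI01 iBS nB) (mxintN mI01 iB).
  rewrite (mxint_congr mI01 B iSigma) -!int01E int01_cst -Sigma_starE.
  by rewrite mulVmx ?posdef_unitmx// mul1mx Bt opprD addNKr.
apply: nonneg_definite_mxint => //; first exact: mxintegrableD.
move=> u; rewrite /I01 /= in_itv /= => u01.
apply: square_completion => //; first exact: posdef_S_star.
exact: partial_out_first.
Qed.

End Partial_regression_bound.

Theorem mainTheorem5 (R : realType) (d d' : measure_display)
    (T : measurableType d) (E : measurableType d') (P : probability T R)
    (p1 p2 : nat) (M : regression R T E p1 p2)
    (p : R -> 'cV[R]_(p1 + p2) -> R) (i : int)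
    (A := first_coords R p1 p2) :
  innovations P (xi M) (xi' M) ->
  regression_model P M ->
  stationary_approximation P M ->
  weighted_assumptions P M p ->
  weighted_assumptions P M (fun u x => (sigma M u x)^-1) ->
  loewner_le
    (int01 (fun u => A *m invmx (S_star P M i u) *m A^T))
    (int01 (fun u => A *m invmx (S1 P M p i u) *m S2 P M p i u
                       *m invmx (S1 P M p i u) *m A^T)) /\
  loewner_le
    (invmx (Sigma_star P M i))
    (int01 (fun u => A *m invmx (S_star P M i u) *m A^T)).
Proof.
move=> inn rm sa wp ws; split; first exact: sandwich_bound.
exact: partial_regression_bound.
Qed.
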